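(* Let $M^2$ be a connected $2$-manifold and let $f:M^2\to\mathbb{R}^3$ be a complete flat front with at least one singular point. Then one of the two ends of $f$ is properly embedded if and only if the other end is properly embedded. Moreover, the ends of $f$ are properly embedded if and only if the Gauss map image of $f$, regarded as the closed spherical curve $\hat\nu:S^1\to S^2$, is a convex curve.
   Context: All manifolds and maps are $C^\infty$. A $C^\infty$ map $f:M^2\to\mathbb{R}^3$ is a front if there is a smooth map $\nu:M^2\to S^2$ (Gauss map) with $\nu(p)\perp df(T_pM^2)$ for all $p$ such that $(f,\nu):M^2\to\mathbb{R}^3\times S^2$ is an immersion. A front is flat if $\operatorname{rank} d\nu\le1$ everywhere. A point is singular if $f$ is not an immersion near it. A flat front with $ds^2=df\cdot df$ is complete if there is a symmetric covariant $2$-tensor $T$ on $M^2$ with compact support such that $ds^2+T$ is a complete Riemannian metric. Ends and Gauss map: a complete flat front on a connected $M^2$ with non-empty singular set can be written, up to a diffeomorphism $S^1\times\mathbb{R}\cong M^2$ ($S^1=\mathbb{R}/2\pi\mathbb{Z}$) and a translation, as $f(t,v)=\hat\sigma(t)+v\hat\xi(t)$ with $\hat\sigma(t)=\int_0^t a(s)\hat\xi(s)\,ds$, where $a$ is a smooth function on $S^1$, $\hat\xi:S^1\to S^2$ is a regular curve with nowhere vanishing geodesic curvature, and $\int_0^{2\pi}a\hat\xi\,dt=0$. Its Gauss map depends only on $t$: $\nu(t,v)=\hat\nu(t)$, where the closed curve $\hat\nu:S^1\to S^2$ is the spherical dual of $\hat\xi$ (i.e. $\hat\nu\cdot\hat\xi=\hat\nu\cdot\hat\xi'=0$).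 The two ends of $f$ are represented by $\{v>0\}$ and $\{v<0\}$ (with $|v|$ large). The end $\{v>0\}$ is properly embedded if for some $c>0$ the restriction of $f$ to $\{v\ge c\}$ is a proper injective immersion; similarly for $\{v<0\}$ with $\{v\le -c\}$. A convex curve in $S^2$ is a simple closed regular curve in $S^2$ with nowhere vanishing geodesic curvature. *)

(* Defs.v *)
From HB Require Import structures.
From mathcomp Require Import all_boot all_order all_algebra.
From mathcomp Require Import all_classical all_reals all_analysis.

Set Implicit Arguments.
Unset Strict Implicit.
Unset Printing Implicit Defensive.

Import Order.TTheory GRing.Theory Num.Theory.
Import numFieldNormedType.Exports.

Local Open Scope classical_set_scope.
Local Open Scope ring_scope.

(* The topology of 'rV[R]_n comes from the sup norm; Euclidean geometry always
   goes through [dot]. *)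
Definition dot (R : realType) (n : nat) (u w : 'rV[R]_n) : R :=
  (u *m w^T) 0 0.

Definition enorm (R : realType) (n : nat) (u : 'rV[R]_n) : R :=
  Num.sqrt (dot u u).

Definition bilin (R : realType) (n : nat) (G : 'M[R]_n) (u w : 'rV[R]_n) : R :=
  (u *m G *m w^T) 0 0.

(* For finite-dimensional V and open U this is the usual class C^n: all iterated
   directional derivatives of order <= n exist and are continuous on U. *)
Fixpoint Cn (R : realType) (V W : normedModType R) (n : nat) (U : set V)
    (f : V -> W) : Prop :=
  (forall x, U x -> {for x, continuous f}) /\
  (if n is m.+1 then
     forall v, (forall x, U x -> derivable f x v) /\ Cn m U ('D_v f)
   else True).

Definition smooth_on (R : realType) (V W : normedModType R) (U : set V)
    (f : V -> W) : Prop :=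
  forall n, Cn n U f.

(* The values of [chart_map] off [chart_dom], and of [chart_inv] off the image
   of [chart_dom], are irrelevant. *)
Record chart (R : realType) (M : topologicalType) := Chart {
  chart_dom : set M;
  chart_map :> M -> 'rV[R]_2;
  chart_inv : 'rV[R]_2 -> M;
  chart_dom_open : open chart_dom;
  chart_img_open : open (chart_map @` chart_dom);
  chart_mapK : forall p, chart_dom p -> chart_inv (chart_map p) = p;
  chart_map_cont : forall p, chart_dom p -> {for p, continuous chart_map};
  chart_inv_cont : forall p, chart_dom p ->
    {for chart_map p, continuous chart_inv} }.

Record surface (R : realType) := Surface {
  surface_top :> topologicalType;
  atlas : set (chart R surface_top);
  surface_hausdorff : hausdorff_space surface_top;
  surface_second_countable : @second_countable surface_top;
  atlas_cover : forall p : surface_top, exists2 c, atlas c & chart_dom c p;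
  atlas_compat : forall c d, atlas c -> atlas d ->
    smooth_on (c @` (chart_dom c `&` chart_dom d)) (d \o chart_inv c) }.

Definition smooth_map_on (R : realType) (M : surface R) (W : normedModType R)
    (U : set M) (f : M -> W) : Prop :=
  forall c, atlas c ->
    smooth_on (c @` (chart_dom c `&` U)) (f \o chart_inv c).

Definition smooth_map (R : realType) (M : surface R) (W : normedModType R)
    (f : M -> W) : Prop :=
  smooth_map_on [set: M] f.

Definition smooth_into (R : realType) (V : normedModType R) (M : surface R)
    (g : V -> M) : Prop :=
  continuous g /\
  forall c, atlas c -> smooth_on (g @^-1` chart_dom c) (c \o g).

(* Image under df of the tangent vector at p with coordinates u in the chart c. *)
Definition dchart (R : realType) (M : surface R) (W : normedModType R)
    (c : chart R M) (f : M -> W) (p : M) (u : 'rV[R]_2) : W :=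
  'D_u (f \o chart_inv c) (c p).

Section Fronts.
Variables (R : realType) (M : surface R).
Implicit Types f nu : M -> 'rV[R]_3.

Definition immersion_at f (p : M) : Prop :=
  forall c, atlas c -> chart_dom c p ->
  forall u, dchart c f p u = 0 -> u = 0.

Definition singular_point f (p : M) : Prop :=
  ~ (\forall q \near p, immersion_at f q).

(* f is a front with Gauss map nu. *)
Definition front f nu : Prop :=
  [/\ smooth_map f,
      smooth_map nu,
      (forall p, dot (nu p) (nu p) = 1),
      (forall c, atlas c -> forall p, chart_dom c p ->
         forall u, dot (nu p) (dchart c f p u) = 0)
    & (forall c, atlas c -> forall p, chart_dom c p ->
         forall u, dchart c f p u = 0 -> dchart c nu p u = 0 -> u = 0)].

Definition flat nu : Prop :=
  forall c, atlas c -> forall p, chart_dom c p ->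
  (\rank (\matrix_(i < 2) dchart c nu p (delta_mx 0%R i)) <= 1)%N.

(* A covariant 2-tensor is given by its component matrices [T c p] with respect
   to the charts c around p. *)
Definition tensor_transforms (T : chart R M -> M -> 'M[R]_2) : Prop :=
  forall c d, atlas c -> atlas d ->
  forall p, chart_dom c p -> chart_dom d p ->
  forall u w, bilin (T c p) u w =
              bilin (T d p) (dchart c d p u) (dchart c d p w).

Definition sym_tensor (T : chart R M -> M -> 'M[R]_2) : Prop :=
  [/\ (forall c, atlas c -> smooth_on (c @` chart_dom c) (T c \o chart_inv c)),
      (forall c, atlas c -> forall p, chart_dom c p -> (T c p)^T = T c p)
    & tensor_transforms T].

Definition tensor_support (T : chart R M -> M -> 'M[R]_2) : set M :=
  closure [set p | exists c, [/\ atlas c, chart_dom c p & T c p != 0]].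

Definition first_form f (c : chart R M) (p : M) : 'M[R]_2 :=
  \matrix_(i < 2, j < 2)
    dot (dchart c f p (delta_mx 0 i)) (dchart c f p (delta_mx 0 j)).

Definition riemannian_metric (g : chart R M -> M -> 'M[R]_2) : Prop :=
  sym_tensor g /\
  forall c, atlas c -> forall p, chart_dom c p ->
  forall u, u != 0 -> 0 < bilin (g c p) u u.

Definition is_speed (g : chart R M -> M -> 'M[R]_2) (gamma : R -> M)
    (s : R -> R) : Prop :=
  forall t c, atlas c -> chart_dom c (gamma t) ->
  s t = Num.sqrt (bilin (g c (gamma t)) (derive1 (c \o gamma) t)
                                        (derive1 (c \o gamma) t)).

(* Restricting to C^oo curves gives the same infimum as piecewise C^1 ones:
   corners can be traversed with vanishing velocity. *)
Definition riemannian_dist (g : chart R M -> M -> 'M[R]_2) (p q : M) : \bar R :=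
  ereal_inf [set l | exists (gamma : R -> M) (s : R -> R),
    [/\ smooth_into gamma, gamma 0 = p, gamma 1 = q, is_speed g gamma s
      & l = (\int[lebesgue_measure]_(t in `[0%R, 1%R]) (s t)%:E)%E]].

Definition complete_metric (g : chart R M -> M -> 'M[R]_2) : Prop :=
  riemannian_metric g /\
  forall u : nat -> M,
    (forall e : R, 0 < e -> exists N, forall m n, (N <= m)%N -> (N <= n)%N ->
       (riemannian_dist g (u m) (u n) < e%:E)%E) ->
    exists p, forall e : R, 0 < e -> exists N, forall n, (N <= n)%N ->
       (riemannian_dist g (u n) p < e%:E)%E.

Definition complete_front f : Prop :=
  exists T : chart R M -> M -> 'M[R]_2,
    [/\ sym_tensor T, compact (tensor_support T)
      & complete_metric (fun c p => first_form f c p + T c p)].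

(* Maps on S^1 = R/2piZ are 2pi-periodic maps on R. *)
Definition eq_mod_2pi (s t : R) : Prop := exists k : int, s = t + 2 * pi * k%:~R.

Definition closed_spherical_curve (gamma : R -> 'rV[R]_3) : Prop :=
  [/\ smooth_on [set: R] gamma,
      (forall t, gamma (t + 2 * pi) = gamma t)
    & (forall t, dot (gamma t) (gamma t) = 1)].

Definition regular_curve (gamma : R -> 'rV[R]_3) : Prop :=
  forall t, derive1 gamma t != 0.

Definition geodesic_curvature (gamma : R -> 'rV[R]_3) (t : R) : R :=
  \det (\matrix_(i < 3) nth 0 [:: gamma t; derive1 gamma t;
                                  derive1 (derive1 gamma) t] i)
  / enorm (derive1 gamma t) ^+ 3.

Definition convex_curve (gamma : R -> 'rV[R]_3) : Prop :=
  [/\ closed_spherical_curve gamma,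
      (forall s t, gamma s = gamma t -> eq_mod_2pi s t),
      regular_curve gamma
    & (forall t, geodesic_curvature gamma t != 0)].

Definition spherical_dual (xi nuh : R -> 'rV[R]_3) : Prop :=
  closed_spherical_curve nuh /\
  forall t, dot (nuh t) (xi t) = 0 /\ dot (nuh t) (derive1 xi t) = 0.

(* A diffeomorphism S^1 x R -> M, given as a map on R x R: smooth, factoring
   through a bijection from (R/2piZ) x R, with smooth inverse, i.e. the inverse
   lifts locally to a smooth map into R x R. *)
Definition cylinder_diffeo (phi : R * R -> M) : Prop :=
  [/\ smooth_into phi,
      (forall x y, phi x = phi y <-> eq_mod_2pi x.1 y.1 /\ x.2 = y.2),
      (forall p, exists x, phi x = p)
    & (forall p, exists (U : set M) (l : M -> R * R),
         [/\ open U, U p, smooth_map_on U l & forall q, U q -> phi (l q) = q])].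

Definition oriented_integral (h : R -> R) (t : R) : R :=
  (\int[lebesgue_measure]_(s in `[0, t]) h s) -
  (\int[lebesgue_measure]_(s in `[t, 0]) h s).

Definition sigma_hat (a : R -> R) (xi : R -> 'rV[R]_3) (t : R) : 'rV[R]_3 :=
  \row_i oriented_integral (fun s => a s * xi s 0 i) t.

(* The front f with Gauss map nu reads sigma_hat(t) + v xi(t), up to the
   translation b, in the cylinder coordinates (t, v) given by phi; nuh is its
   Gauss map as a closed curve. *)
Definition normal_form f nu (phi : R * R -> M) (b : 'rV[R]_3)
    (a : R -> R) (xi nuh : R -> 'rV[R]_3) : Prop :=
  [/\ cylinder_diffeo phi,
      smooth_on [set: R] a /\ (forall t, a (t + 2 * pi) = a t),
      [/\ closed_spherical_curve xi, regular_curve xi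
        & forall t, geodesic_curvature xi t != 0],
      sigma_hat a xi (2 * pi) = 0
    & [/\ (forall t v, f (phi (t, v)) = b + sigma_hat a xi t + v *: xi t),
          (forall t v, nu (phi (t, v)) = nuh t)
        & spherical_dual xi nuh]].

Definition proper_injective_immersion_on f (E : set M) : Prop :=
  [/\ (forall K : set 'rV[R]_3, compact K -> compact (E `&` f @^-1` K)),
      {in E &, injective f}
    & (forall p, E p -> immersion_at f p)].

Definition upper_end_properly_embedded f (phi : R * R -> M) : Prop :=
  exists2 c : R, 0 < c &
    proper_injective_immersion_on f (phi @` [set x | c <= x.2]).

Definition lower_end_properly_embedded f (phi : R * R -> M) : Prop :=
  exists2 c : R, 0 < c &
    proper_injective_immersion_on f (phi @` [set x | x.2 <= - c]).

End Fronts.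

(* Main.v *)
(* The end {v > 0} is always proper and immersed, so it is properly embedded iff
   f is injective for large v.  Both ends are shown to be properly embedded iff
   xi is simple, and xi is simple iff its dual nu is.

   The main tool is that a simple closed locally convex spherical curve c is
   globally convex: det (c r, c' r, c e) has no zero off the diagonal.  In a
   shortest tangency (r, e) off the diagonal the curve or its time reversal
   spirals into a convex cone, from which it can never escape, contradicting
   periodicity.  The argument uses only the intermediate value theorem and
   compactness, no rotation index.

   Duality: c(r) x c'(r) is a multiple of the dual point at r, which therefore
   is not orthogonal to c(e), and a coincidence of dual points is impossible.
   From xi to f: at a self-intersection the component of f along nu(r) gives
   |v| <= B, because the component of sigma(e) - sigma(r) is O(xi(e) . nu(r)).
   From f to xi: the sections of an embedded end by large spheres are simple
   curves, convex since they are C^2-close to xi; convexity passes to the limit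
   in a form that excludes double points of xi. *)

Require Import Defs.
From mathcomp Require Import all_boot all_order all_algebra.
From mathcomp Require Import all_classical all_reals all_analysis.
From mathcomp Require Import ring lra.

Set Implicit Arguments.
Unset Strict Implicit.
Unset Printing Implicit Defensive.

Import Order.TTheory GRing.Theory Num.Theory.
Import numFieldNormedType.Exports.

Local Open Scope classical_set_scope.
Local Open Scope ring_scope.

(** A tangency on a closed curve has two lags, one looking forward from the point of tangency and
    one looking backward; together they make a period. Which of the two can be shortest is not known
    in advance, and this is why the argument runs on an abstract function of two times whose axioms
    survive time reversal. The obstacle in passing from the end to xi is that a limit of simple
    curves need not be simple. What rescues the limit is a strict sign: local convexity of xi
    orients three nearby points strictly, and this persists under perturbation, while a double point
    lets the middle one be replaced by a point that comes last in cyclic order. On the way back,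
    sigma' is parallel to xi, so the tangent plane of f along a ruling is spanned by xi and xi', as
    for the cone over xi. One determinant therefore controls both the spherical curve and the
    front. *)

(** * Congruence modulo a period and sign arguments on the line *)

Definition eqmod (R : realType) (P s t : R) : Prop :=
  exists k : int, s = t + P * k%:~R.

Lemma eqmod_sym (R : realType) (P s t : R) : eqmod P s t -> eqmod P t s.
Proof. by move=> [k ->]; exists (- k); rewrite mulrNz mulrN addrK. Qed.

Lemma eqmod_dist_lt (R : realType) (P s t : R) :
  0 < `|s - t| < P -> ~ eqmod P s t.
Proof.
move=> /andP[st stP] [k skt]; move: st stP; rewrite {}skt addrAC subrr add0r.
rewrite normr_gt0 mulf_eq0 negb_or => /andP[P0 k0]; rewrite normrM => h.
have k1 : 1 <= `|k%:~R : R|.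
  by rewrite -intr_norm (ler_int _ 1) -gtz0_ge1 normr_gt0 -(intr_eq0 R).
have : `|P| * 1 < P by apply: le_lt_trans h; rewrite ler_wpM2l.
by rewrite mulr1 ltNge ler_norm.
Qed.

Lemma eqmod_itv (R : realType) (P a t : R) : 0 < P ->
  exists k : int, a <= t + P * k%:~R < a + P.
Proof.
move=> P0; pose k := Num.floor ((t - a) / P); exists (- k).
have /andP[k1 k2] := floor_itv ((t - a) / P); rewrite -/k in k1 k2.
rewrite mulrNz mulrN; move: k1 k2; rewrite intrD ler_pdivlMr// ltr_pdivrMr// => k1 k2.
apply/andP; split; nra.
Qed.

Lemma periodicZ (R : realType) (T : Type) (P : R) (f : R -> T) :
  (forall t, f (t + P) = f t) -> forall t (k : int), f (t + P * k%:~R) = f t.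
Proof.
move=> fP; have H t (n : nat) : f (t + P * n%:R) = f t.
  elim: n t => [|n IH] t; first by rewrite mulr0 addr0.
  by rewrite -addn1 natrD mulrDr mulr1 addrA fP IH.
move=> t [n|n]; first exact: H.
by rewrite NegzE mulrNz mulrN -(H (t - _) n.+1) subrK.
Qed.

Lemma ivt_zero (R : realType) (f : R -> R) (a b : R) :
  continuous f -> a <= b -> 0 < f a -> f b < 0 ->
  exists2 c, a < c < b & f c = 0.
Proof.
move=> cf ab fa fb; have [||c cab fc] := @IVT R f a b 0 ab.
- exact: continuous_subspaceT.
- by rewrite ge_min le_max (ltW fa) (ltW fb) !orbT.
exists c => //; move: cab; rewrite in_itv/= !le_eqVlt.
case/andP=> /predU1P[ac|->]; last (case/predU1P=> [cb|->//]; by rewrite -cb fc ltxx in fb).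
by rewrite ac fc ltxx in fa.
Qed.

Lemma pos_of_nonzero (R : realType) (f : R -> R) (a b : R) :
  continuous f -> (exists2 c, a < c < b & 0 < f c) ->
  (forall x, a < x < b -> f x != 0) -> forall x, a < x < b -> 0 < f x.
Proof.
move=> cf [c /andP[ac cb] fc] f0 x /andP[ax xb].
rewrite ltNge le_eqVlt negb_or f0 ?ax//=; apply/negP => fx.
have [cx|xc] := leP c x.
  have [y /andP[cy yx] fy] := ivt_zero cf cx fc fx.
  by move: (f0 y); rewrite fy eqxx (lt_trans ac cy) (lt_trans yx xb) => /(_ isT).
have cNf : continuous (- f) by move=> y; apply: continuousN; exact: cf.
have [|| y /andP[cy yx] fy] := ivt_zero cNf (ltW xc).
- by rewrite oppr_gt0.
- by rewrite oppr_lt0.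
move: (f0 y); move/eqP: fy; rewrite oppr_eq0 => -> .
by rewrite (lt_trans ax cy) (lt_trans yx cb) => /(_ isT).
Qed.

Lemma ge0_closure (R : realType) (f : R -> R) (a b : R) :
  continuous f -> a < b -> (forall x, a < x < b -> 0 < f x) ->
  0 <= f a /\ 0 <= f b.
Proof.
move=> cf ab fp; have mab : a < (a + b) / 2 < b by apply/andP; split; lra.
have [am mb] := andP mab.
split; rewrite leNgt; apply/negP => fn.
- have cNf : continuous (- f) by move=> y; apply: continuousN; exact: cf.
  have [|| y /andP[cy yx] fy] := ivt_zero cNf (ltW am).
  + by rewrite oppr_gt0.
  + by rewrite oppr_lt0 fp.
  have := fp y; move/eqP: fy; rewrite oppr_eq0 => /eqP ->.
  by rewrite ltxx cy (lt_trans yx mb) => /(_ isT).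
- have [|y /andP[cy yx] fy] := ivt_zero cf (ltW mb) _ fn; first exact: fp.
  by have := fp y; rewrite fy ltxx yx (lt_trans am cy) => /(_ isT).
Qed.

Lemma closed_le_fct (R : realType) (T : topologicalType) (f g : T -> R) :
  continuous f -> continuous g -> closed [set x | f x <= g x].
Proof.
move=> cf cg.
have -> : [set x | f x <= g x] = (g - f) @^-1` [set y | 0 <= y].
  by apply/seteqP; split=> x /=; rewrite subr_ge0.
apply: closed_comp; last exact: closed_ge.
by move=> x _; apply: continuousB; [exact: cg | exact: cf].
Qed.

Lemma closed_argmin (R : realType) (C : set (R * R)) (f : R * R -> R) (m : R) :
  closed C -> C !=set0 -> continuous f ->
  (forall p, C p -> `|p.1| <= m /\ `|p.2| <= m) ->
  exists2 c, C c & forall p, C p -> f c <= f p.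
Proof.
move=> clC C0 cf Cm.
have cC : compact C.
  apply: (subclosed_compact clC (compact_setX (@segment_compact _ (-m) m)
    (@segment_compact _ (-m) m))) => p /Cm [p1 p2].
  by split => /=; rewrite in_itv/= -ler_norml.
have [c cC' cmin] := compact_EVT_min C0 cC (continuous_subspaceT cf).
by exists c; [rewrite inE in cC' | move=> p Cp; apply: cmin; rewrite inE].
Qed.

(** * Tangent planes of closed convex curves *)

(* The properties of [g r e = det (c r, c' r, c e)], the position of the point at
   time [e] relative to the tangent plane at time [r], for a closed locally
   convex curve [c] no two points of which lie on the same ray.  They are stable
   under [g r e |-> g (- r) (- e)], which corresponds to [t |-> - c (- t)]. *)
Record tangent_function (R : realType) (P : R) (g : R -> R -> R) : Prop :=
  TangentFunction {
    tg_periodl : forall r e, g (r + P) e = g r e;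
    tg_periodr : forall r e, g r (e + P) = g r e;
    tg_cont : continuous (fun p : R * R => g p.1 p.2);
    tg_near : exists2 d, 0 < d & forall r e, 0 < `|e - r| < d -> 0 < g r e;
    tg_touch : forall r e h, 0 < h -> g r e = 0 ->
      (forall x, `|x - r| < h -> 0 <= g x e) -> eqmod P e r;
    tg_right : forall s t e h, 0 < h -> g s t = 0 ->
      (forall x, t <= x <= t + h -> 0 <= g s x) -> g t e = 0 ->
      (forall x, t <= x <= t + h -> 0 <= g x e) -> g s e <= 0;
    tg_left : forall s t e h, 0 < h -> g s t = 0 ->
      (forall x, t - h <= x <= t -> 0 <= g s x) -> g t e = 0 ->
      (forall x, t - h <= x <= t -> 0 <= g x e) -> g s e <= 0;
    tg_double : forall s t u, g t s = 0 -> g s t = 0 -> 0 < g u s -> 0 < g u t ->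
      (forall x, 0 <= g (t + x) (s + x)) -> eqmod P s t }.

Lemma tangent_function_rev (R : realType) (P : R) (g : R -> R -> R) :
  tangent_function P g -> tangent_function P (fun r e => g (- r) (- e)).
Proof.
case=> gl gr gc gn gt gri gle gd.
have NP t : - t = - (t + P) + P by rewrite opprD subrK.
split.
- by move=> r e; rewrite [in RHS]NP gl.
- by move=> r e; rewrite [in RHS](NP e) gr.
- move=> p; apply: (@continuous_comp _ _ _ (fun p : R * R => - p)
    (fun p : R * R => g p.1 p.2)); [exact: opp_continuous | exact: gc].
- have [d d0 H] := gn; exists d => // r e h; apply: H.
  by rewrite -opprD normrN.
- move=> r e h h0 g0 H.
  have [|k E] := gt _ _ _ h0 g0.
    by move=> x xr; rewrite -(opprK x); apply: H; rewrite -opprD normrN -[r]opprK.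
  by exists (- k); rewrite mulrNz mulrN -[LHS]opprK E opprD opprK.
- move=> s t e h h0 g0 H g1 H'; apply: (gle (- s) (- t) (- e) h) => // x xt.
    by rewrite -(opprK x); apply: H; lra.
  by rewrite -(opprK x); apply: H'; lra.
- move=> s t e h h0 g0 H g1 H'; apply: (gri (- s) (- t) (- e) h) => // x xt.
    by rewrite -(opprK x); apply: H; lra.
  by rewrite -(opprK x); apply: H'; lra.
- move=> s t u g1 g2 g3 g4 H.
  have [|k E] := gd _ _ _ g1 g2 g3 g4.
    by move=> x; have := H (- x); rewrite !opprD !opprK.
  by exists (- k); rewrite mulrNz mulrN -[LHS]opprK E opprD opprK.
Qed.

Lemma continuous_pair (T U V : topologicalType) (f : T -> U) (g : T -> V) (x : T) :
  {for x, continuous f} -> {for x, continuous g} ->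
  {for x, continuous (fun y => (f y, g y))}.
Proof. by move=> cf cg; exact: (@cvg_pair _ _ _ _ _ _ _ _ _ _ _ cf cg). Qed.

Lemma tg_contr (R : realType) (P : R) (g : R -> R -> R) (r : R) :
  tangent_function P g -> continuous (g r).
Proof.
move=> tg e; apply: (@continuous_comp _ _ _ (fun x => (r, x))
  (fun p : R * R => g p.1 p.2)); last exact: tg_cont tg _.
by apply: continuous_pair; [exact: cvg_cst | exact: cvg_id].
Qed.

Lemma tg_contl (R : realType) (P : R) (g : R -> R -> R) (e : R) :
  tangent_function P g -> continuous (g^~ e).
Proof.
move=> tg r; apply: (@continuous_comp _ _ _ (fun x => (x, e))
  (fun p : R * R => g p.1 p.2)); last exact: tg_cont tg _.
by apply: continuous_pair; [exact: cvg_id | exact: cvg_cst].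
Qed.

(** The zeros with lag [e - r] at least [l] in this window form a compact set, so an earliest [e0]
    exists. Since [g r] is positive at lag [l / 2], a negative value [g r e0] would force a zero of
    [g r] before [e0]. *)
Lemma tangent_first_zero (R : realType) (P : R) (g : R -> R -> R) (l a b c : R) :
  tangent_function P g -> 0 < l ->
  (forall r e, 0 < `|e - r| < l -> 0 < g r e) ->
  (exists r e, [/\ a <= r <= b, e <= c, r + l <= e & g r e = 0]) ->
  exists r0 e0, [/\ [/\ a <= r0 <= b, e0 <= c, r0 + l <= e0 & g r0 e0 = 0],
    (forall r e, a <= r <= b -> e <= c -> r + l <= e -> g r e = 0 -> e0 <= e)
    & (forall r, a <= r <= b -> r <= e0 -> 0 <= g r e0)].
Proof.
move=> tg l0 gl [r [e [/andP[ar rb] ec le gre]]].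
pose C := [set p : R * R | [/\ a <= p.1 <= b, p.2 <= c, p.1 + l <= p.2
  & g p.1 p.2 = 0]].
have fstc : continuous (fun p : R * R => p.1) by move=> p; exact: cvg_fst.
have sndc : continuous (fun p : R * R => p.2) by move=> p; exact: cvg_snd.
have cstc (k : R) : continuous (fun _ : R * R => k) by move=> p; exact: cvg_cst.
have clC : closed C.
  have -> : C = [set p | a <= p.1] `&` [set p | p.1 <= b] `&` [set p | p.2 <= c]
      `&` [set p | p.1 + l <= p.2]
      `&` ([set p | g p.1 p.2 <= 0] `&` [set p | 0 <= g p.1 p.2]).
    apply/seteqP; split=> [p [/andP[? ?] ? ? g0]|p [[[[h1 h2] h3] h4] [h5 h6]]].
      by do ![split]; rewrite /= ?g0.
    split=> //; first exact/andP.
    by apply/eqP; rewrite eq_le h5.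
  have gc := tg_cont tg.
  do ![apply: closedI]; apply: closed_le_fct => //.
  by move=> p; apply: cvgD; [exact: cvg_fst | exact: cvg_cst].
have [||[r0 e0] Cre e0min] :=
  @closed_argmin R C snd (`|a| + `|b| + `|c| + l) clC _ sndc.
- by exists (r, e); rewrite /C/=; split=> //; apply/andP.
- move=> [x y]; rewrite /C /= => -[/andP[ax xb] yc ly _].
  have n1 := ler_norm b; have n2 := ler_norm c; have n3 := ler_norm (- a).
  have m1 := normr_ge0 a; have m2 := normr_ge0 b; have m3 := normr_ge0 c.
  by rewrite normrN in n3; rewrite !ler_norml; split; lra.
have [/= /andP[ar0 r0b] e0c le0 g0] := Cre.
have min x y : a <= x <= b -> y <= c -> x + l <= y -> g x y = 0 -> e0 <= y.
  by move=> ? ? ? ?; apply: (e0min (x, y)).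
exists r0, e0; split=> //.
move=> x axb xe0; have cgx := @tg_contr _ _ _ x tg.
have [e0x|e0x] := leP e0 (x + l).
  have [|y xy|g1 g2] := @ge0_closure R (g x) x (x + l) cgx.
  - by rewrite ltrDl.
  - by apply: gl; rewrite gtr0_norm; lra.
  have := xe0; rewrite le_eqVlt => /predU1P[<-//|xe].
  have := e0x; rewrite le_eqVlt => /predU1P[->//|e0x'].
  by apply/ltW/gl; rewrite gtr0_norm; lra.
rewrite leNgt; apply/negP => gn.
have [||y /andP[xy ye] gy] := @ivt_zero R (g x) (x + l / 2) e0 cgx _ _ gn.
- by lra.
- by apply: gl; rewrite addrAC subrr add0r gtr0_norm; lra.
have ly : x + l <= y.
  rewrite leNgt; apply/negP => yl.
  by have := gl x y; rewrite gy ltxx gtr0_norm; [lra|lra].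
have := min x y axb _ ly gy; lra.
Qed.

(* The tangent plane at the later time [s] meets the earlier point [t]: the
   curve spirals inwards and is trapped, from [s] on, in the convex cone bounded
   by the arc [t, s] and a planar sector of the tangent plane at [s].  By
   periodicity it has to leave, hence to meet the tangent plane at [s] again.
   But among the zeros [g rho e = 0] with [r <= rho < e], where [r] is an
   interior point of [t, s], the earliest [e] is attained at [rho = r] only
   (elsewhere [g ^~ e] would have an interior minimum 0), while in the cone the
   plane at [r] is not met again. *)
Lemma no_shortest_backward_tangency (R : realType) (P : R) (g : R -> R -> R)
    (l t s : R) :
  tangent_function P g -> 0 < l -> l < P -> s = t + l -> g s t = 0 ->
  (forall r e, 0 < `|e - r| < l -> 0 < g r e) -> False.
Proof.
move=> tg l0 lP st gst gl.
have P0 : 0 < P by lra.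
have ge0r r : 0 <= g r r /\ 0 <= g r (r + l).
  apply: ge0_closure; [exact: tg_contr tg|by rewrite ltrDl|].
  by move=> x xr; apply: gl; rewrite gtr0_norm; lra.
have ge0l r e : 0 <= `|e - r| <= l -> 0 <= g r e.
  rewrite le_eqVlt => /andP[/predU1P[/esym/eqP|er0]].
    by rewrite normr_eq0 subr_eq0 => /eqP -> _; case: (ge0r r).
  rewrite le_eqVlt => /predU1P[er|er]; last by apply/ltW/gl; rewrite er0.
  have := er; have [er1|er1] := ger0P (e - r).
    by move=> erl; have -> : e = r + l; [lra|case: (ge0r r)].
  move=> erl; have -> : r = e + l by lra.
  have [|x xr|] // := @ge0_closure R (g^~ e) e (e + l) (@tg_contl _ _ _ e tg).
  - by rewrite ltrDl.
  - by apply: gl; rewrite ltr0_norm; lra.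
have neq x y : 0 < `|x - y| < P -> ~ eqmod P x y by exact: eqmod_dist_lt.
(* Shifting both times together keeps the lag at [l], where [g] is nonnegative. If [t] and [s] each
   lay on the tangent plane of the other, [tg_double] would identify them; the midpoint of the arc
   has both strictly on its positive side. *)
have gts : 0 < g t s.
  rewrite lt0r; apply/andP; split; last by apply: ge0l; rewrite ger0_norm; lra.
  apply/eqP => g0; apply: (neq s t); first by rewrite gtr0_norm; lra.
  apply: (@tg_double _ _ _ tg s t (t + l / 2)) => //.
  - by apply: gl; rewrite gtr0_norm; lra.
  - by apply: gl; rewrite ltr0_norm; lra.
  - by move=> x; apply: ge0l; rewrite ger0_norm; lra.
pose r := t + l / 2.
have gstP : g s (t + P) = 0 by rewrite (tg_periodr tg).
have Pl : l <= P - l.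
  rewrite leNgt; apply/negP => Pl.
  suff : 0 < g s (t + P) by rewrite gstP ltxx.
  by apply: gl; rewrite gtr0_norm; lra.
have [|r0 [e0 [[/andP[rr0 r0P] e0P le0 g0] min0 pos0]]] :=
  @tangent_first_zero R P g l r (t + P) (t + P) tg l0 gl.
  by exists s, (t + P); rewrite /r; split=> //; lra.
have int0 x : r < x -> x + l <= e0 -> g x e0 = 0 -> False.
  move=> rx xe gx; apply: (neq e0 x); first by rewrite gtr0_norm; rewrite /r in rx; lra.
  apply: (@tg_touch _ _ _ tg x e0 (Num.min (x - r) l)) => //.
    by rewrite lt_min; lra.
  by move=> y; rewrite lt_min !ltr_norml => y1; apply: pos0; lra.
have r0r : r0 = r.
  apply/eqP; rewrite eq_le rr0 andbT leNgt; apply/negP => rr.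
  exact: (int0 r0).
subst r0.
have gse0 : 0 < g s e0.
  have se0 : s < e0 by rewrite /r in le0; lra.
  have [e0s|e0s] := ltP (e0 - s) l; first by apply: gl; rewrite gtr0_norm; lra.
  rewrite lt0r; apply/andP; split; last by apply: pos0; rewrite /r; lra.
  by apply/eqP => gz; apply: (int0 s) => //; rewrite /r; lra.
(* A second search, now over the whole arc [[t, s]]; the zero at [r] just found makes it nonempty.
   Its result is excluded at [s] by the minimality of [e0] and [gse0], at [t] by [tg_right], and in
   the interior by [tg_touch]. *)
have [|r1 [e1 [[/andP[tr1 r1s] e1e0 le1 g1] min1 pos1]]] :=
  @tangent_first_zero R P g l t s e0 tg l0 gl.
  by exists r, e0; rewrite /r; split=> //; rewrite /r in le0; lra.
have e1s : s < e1.
  rewrite lt_neqAle; apply/andP; split; last lra.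
  apply/eqP => es; have r1t : r1 = t by lra.
  by rewrite r1t -es in g1; lra.
have gse1 : 0 < g s e1.
  have [e1s'|e1s'] := ltP (e1 - s) l; first by apply: gl; rewrite gtr0_norm; lra.
  rewrite lt0r; apply/andP; split; last by apply: pos1; lra.
  apply/eqP => gz; have e01 : e0 <= e1 by apply: (min0 s) => //; rewrite /r; lra.
  have e01' : e1 = e0 by lra.
  by rewrite e01' in gz; lra.
have [r1t|r1t] := eqVneq r1 t.
  suff : g s e1 <= 0 by lra.
  apply: (@tg_right _ _ _ tg s t e1 l) => //.
  - by move=> x xt; apply: ge0l; rewrite ler0_norm; lra.
  - by rewrite -r1t.
  - by move=> x xt; apply: pos1; lra.
have [r1s'|r1s'] := eqVneq r1 s; first by rewrite r1s' in g1; lra.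
have tr1' : t < r1 by rewrite lt_neqAle eq_sym r1t.
have r1s2 : r1 < s by rewrite lt_neqAle r1s'.
apply: (neq e1 r1); first by rewrite gtr0_norm; lra.
apply: (@tg_touch _ _ _ tg r1 e1 (Num.min (r1 - t) (s - r1))) => //.
  by rewrite lt_min; lra.
by move=> y; rewrite lt_min !ltr_norml => y1; apply: pos1; lra.
Qed.

(** Reduced to one period, the zeros off the diagonal form a compact set, on which the lag [e - r]
    attains a minimum [lO] and a maximum [P - lI]. The smaller of [lO] and [lI] belongs to a
    shortest tangency, forward or backward; time reversal turns the forward case into the backward
    one. Once there are no zeros, the sign near the diagonal propagates. *)
Lemma tangent_function_gt0 (R : realType) (P : R) (g : R -> R -> R) :
  0 < P -> tangent_function P g -> forall r e, ~ eqmod P e r -> 0 < g r e.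
Proof.
move=> P0 tg; have [d d0 gd] := tg_near tg.
have cf r := @tg_contr _ _ _ r tg; have cl e := @tg_contl _ _ _ e tg.
have gl r e (k : int) : g (r + P * k%:~R) e = g r e.
  exact: (@periodicZ _ _ P (g^~ e) (fun t => tg_periodl tg t e)).
have gr r e (k : int) : g r (e + P * k%:~R) = g r e.
  exact: (@periodicZ _ _ P (g r) (tg_periodr tg r)).
pose d' := Num.min d (P / 2).
have d'0 : 0 < d' by rewrite lt_min; lra.
have [d'd d'P] : d' <= d /\ d' <= P / 2 by split; rewrite ge_min lexx ?orbT.
(* By [tg_near] no zeros off the diagonal have a lag within [d'] of 0 or [P]; with these margins [C]
   is compact and stays away from the diagonal. *)
pose C := [set p : R * R | [/\ 0 <= p.1 <= P, d' <= p.2 - p.1 <= P - d'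
  & g p.1 p.2 = 0]].
have redC r e : ~ eqmod P e r -> g r e = 0 ->
    exists2 p, C p & exists k l : int, p = (r + P * k%:~R, e + P * l%:~R).
  move=> er gz; have [k k1] := eqmod_itv 0 r P0.
  have [l l1] := eqmod_itv (r + P * k%:~R) e P0.
  set r' := r + _ in k1 l1; set e' := e + _ in l1.
  have g' : g r' e' = 0 by rewrite gl gr.
  have er' : e' != r'.
    apply/eqP => E; apply: er; exists (k - l); rewrite intrB mulrBr.
    by rewrite addrA -/r' -E /e' addrK.
  exists (r', e'); last by exists k, l.
  have [l2|l2] := ltP (e' - r') d'.
    suff : 0 < g r' e' by rewrite g' ltxx.
    have re' : r' < e' by rewrite lt_neqAle eq_sym er'; lra.
    by apply: gd; rewrite gtr0_norm; lra.
  have [l3|l3] := ltP (P - d') (e' - r').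
    suff : 0 < g (r' + P) e' by rewrite (tg_periodl tg) g' ltxx.
    by apply: gd; rewrite ltr0_norm; lra.
  by split => //=; lra.
have boundC p : C p -> `|p.1| <= P + P /\ `|p.2| <= P + P.
  by case: p => x y; rewrite /C /= => -[? ? _]; rewrite !ler_norml; lra.
have fstc : continuous (fun p : R * R => p.1) by move=> p; exact: cvg_fst.
have sndc : continuous (fun p : R * R => p.2) by move=> p; exact: cvg_snd.
have difc : continuous (fun p : R * R => p.2 - p.1).
  by move=> p; apply: cvgB; [exact: cvg_snd | exact: cvg_fst].
have sumc : continuous (fun p : R * R => p.1 - p.2).
  by move=> p; apply: cvgB; [exact: cvg_fst | exact: cvg_snd].
have clC : closed C.
  have -> : C = [set p | 0 <= p.1] `&` [set p | p.1 <= P] `&` [set p | d' <= p.2 - p.1]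
      `&` [set p | p.2 - p.1 <= P - d']
      `&` ([set p | g p.1 p.2 <= 0] `&` [set p | 0 <= g p.1 p.2]).
    apply/seteqP; split=> [p [/andP[? ?] /andP[? ?] g0]|p [[[[h1 h2] h3] h4] [h5 h6]]].
      by do ![split]; rewrite /= ?g0.
    by split; [exact/andP | exact/andP | apply/eqP; rewrite eq_le h5].
  have gc := tg_cont tg; have cstc (k : R) : continuous (fun _ : R * R => k).
    by move=> p; exact: cvg_cst.
  by do ![apply: closedI]; apply: closed_le_fct.
have C0 : C = set0.
  apply/eqP; apply: contrapT => /negP/set0P Cn0.
  have [p1 [_ /andP[d1 D1] z1] min1] := closed_argmin clC Cn0 difc boundC.
  have [p2 [_ /andP[d2 D2] z2] min2] := closed_argmin clC Cn0 sumc boundC.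
  have between r e : 0 < e - r < P -> g r e = 0 ->
      p1.2 - p1.1 <= e - r <= p2.2 - p2.1.
    move=> er gz; have [|p Cp [k [l pE]]] := redC r e _ gz.
      by apply: eqmod_dist_lt; rewrite gtr0_norm; lra.
    have E : p.2 - p.1 = e - r.
      apply/eqP; rewrite -subr_eq0 -normr_eq0; apply/negPn/negP => nz.
      have [_ pd _] := Cp.
      apply: (@eqmod_dist_lt _ P (p.2 - p.1) (e - r)).
        by rewrite lt0r nz normr_ge0 ltr_norml; lra.
      by exists (l - k); rewrite pE/= intrB; ring.
    by have := min1 _ Cp; have := min2 _ Cp; lra.
  pose lO := p1.2 - p1.1; pose lI := P - (p2.2 - p2.1).
  have pos l : l <= lO -> l <= lI -> d' <= l ->
      forall r e, 0 < `|e - r| < l -> 0 < g r e.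
    rewrite /lO /lI => h1 h2 h3 r e; have [er|er] := ger0P (e - r) => erl.
      apply: (@pos_of_nonzero R (g r) r (r + l)) => //; last lra.
        by exists (r + d' / 2); [|apply: gd; rewrite gtr0_norm]; lra.
      move=> x xr; apply/eqP => gz; have := @between r x; rewrite gz; lra.
    apply: (@pos_of_nonzero R (g^~ e) e (e + l)) => //; last lra.
      by exists (e + d' / 2); [|apply: gd; rewrite ltr0_norm]; lra.
    move=> x xr; apply/eqP => gz; have := @between x (e + P).
    by rewrite (tg_periodr tg) gz; lra.
  have [lIO|lIO] := leP lI lO.
    apply: (@no_shortest_backward_tangency R P g lI p2.2 (p2.1 + P)) => //.
    - by rewrite /lI; lra.
    - by rewrite /lI; lra.
    - by rewrite /lI; ring.
    - by rewrite (tg_periodl tg).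
    - by apply: pos => //; rewrite /lI; lra.
  apply: (@no_shortest_backward_tangency R P (fun r e => g (- r) (- e)) lO
      (- p1.2) (- p1.1)) => //.
  - exact: tangent_function_rev.
  - by rewrite /lO; lra.
  - by rewrite /lO; lra.
  - by rewrite /lO; ring.
  - by rewrite !opprK.
  - move=> r e er; apply: (pos lO) => //; rewrite ?(ltW lIO)//.
    by rewrite -opprD normrN.
have nz r e : ~ eqmod P e r -> g r e != 0.
  by move=> er; apply/eqP => /(redC r e er)[p]; rewrite C0.
move=> r e er; have [l l1] := eqmod_itv r e P0.
rewrite -(gr r e l); set e' := e + _ in l1 *.
have er' : e' != r.
  apply/eqP => E; apply: er; exists (- l).
  by rewrite -E /e' mulrNz mulrN addrK.
apply: (@pos_of_nonzero R (g r) r (r + P)) => //.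
- by exists (r + d' / 2); [|apply: gd; rewrite gtr0_norm]; lra.
- by move=> x xr; apply: nz; apply: eqmod_dist_lt; rewrite gtr0_norm; lra.
- by rewrite lt_neqAle eq_sym er'; lra.
Qed.

(** * Determinants and derivatives of space curves *)

(** A polynomial in the coordinates, so that the vector identities below become goals for [ring]. *)
Definition det3 (R : realType) (u v w : 'rV[R]_3) : R :=
  u 0 0 * (v 0 1 * w 0 2%:R - v 0 2%:R * w 0 1)
  - u 0 1 * (v 0 0 * w 0 2%:R - v 0 2%:R * w 0 0)
  + u 0 2%:R * (v 0 0 * w 0 1 - v 0 1 * w 0 0).

(** Ordinals coming from big operators and from numerals differ syntactically; reading coordinates
    through a function on [nat] makes equal entries the same atom for [ring]. *)
Lemma rV_nat_coord (R : realType) n (u : 'rV[R]_n.+1) :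
  exists f : nat -> R, forall i, u 0 i = f i.
Proof. by exists (fun k => u 0 (inord k)) => i; rewrite inord_val. Qed.

Lemma det_rows3 (R : realType) (u v w : 'rV[R]_3) :
  \det (\matrix_(i < 3) nth 0 [:: u; v; w] i) = det3 u v w.
Proof.
rewrite (expand_det_row _ ord0) !big_ord_recl big_ord0 /cofactor.
rewrite !(expand_det_row _ ord0) !big_ord_recl !big_ord0 /cofactor !det_mx11 !mxE /=.
rewrite /det3; have [f uf] := rV_nat_coord u; have [g vg] := rV_nat_coord v.
have [h wh] := rV_nat_coord w; rewrite !(uf, vg, wh) /=.
rewrite /bump /= !(expr0, expr1, addn0, add0n, addn1) expr2; ring.
Qed.

Lemma dot3E (R : realType) (u w : 'rV[R]_3) :
  dot u w = u 0 0 * w 0 0 + u 0 1 * w 0 1 + u 0 2%:R * w 0 2%:R.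
Proof.
rewrite /dot mxE !big_ord_recl big_ord0 !mxE addr0 addrA.
have [f uf] := rV_nat_coord u; have [g vg] := rV_nat_coord w.
by rewrite !(uf, vg).
Qed.

Lemma row3P (R : realType) (u w : 'rV[R]_3) :
  u 0 0 = w 0 0 -> u 0 1 = w 0 1 -> u 0 2%:R = w 0 2%:R -> u = w.
Proof.
have [f uf] := rV_nat_coord u; have [g vg] := rV_nat_coord w.
rewrite !(uf, vg) => h0 h1 h2; apply/rowP => -[[|[|[|//]]] i3]; by rewrite uf vg.
Qed.

Lemma dot3_eq0 (R : realType) (u : 'rV[R]_3) : dot u u = 0 -> u = 0.
Proof.
rewrite dot3E => z.
have h0 := sqr_ge0 (u 0 0); have h1 := sqr_ge0 (u 0 1); have h2 := sqr_ge0 (u 0 2%:R).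
rewrite !expr2 in h0 h1 h2.
by apply: row3P; rewrite mxE; apply/eqP; rewrite -sqrf_eq0 expr2; apply/eqP; lra.
Qed.

Lemma dot3_ge0 (R : realType) (u : 'rV[R]_3) : 0 <= dot u u.
Proof. by rewrite dot3E !addr_ge0// -expr2 sqr_ge0. Qed.

Lemma is_derive_shiftl (R : realType) (f : R -> R) (a x df : R) :
  is_derive (a + x) 1 f df -> is_derive x 1 (fun y => f (a + y)) df.
Proof.
move=> hf; have h1 : is_derive x 1 (fun y : R => a + y) 1.
  have := is_deriveD (is_derive_cst a x 1) (is_derive_id x (1 : R)).
  by rewrite add0r.
by have := is_derive1_comp hf h1; rewrite mulr1.
Qed.

Lemma is_derive_opp_arg (R : realType) (f : R -> R) (x df : R) :
  is_derive (- x) 1 f df -> is_derive x 1 (fun y => f (- y)) (- df).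
Proof.
move=> hf; have := is_derive1_comp hf (is_deriveNid x 1).
by rewrite mulrN1.
Qed.

Lemma is_derive_uniq (R : realType) (f : R -> R) (x d d' : R) :
  is_derive x 1 f d -> is_derive x 1 f d' -> d = d'.
Proof. by case=> _ <- [_ <-]. Qed.

Definition curve_derive (R : realType) (c c' : R -> 'rV[R]_3) : Prop :=
  forall (t : R) (i : 'I_3), is_derive t 1 (fun x => c x 0 i) (c' t 0 i).

Lemma is_derive_det3 (R : realType) (u v w u' v' w' : R -> 'rV[R]_3) (t : R) :
  (forall i, is_derive t 1 (fun x => u x 0 i) (u' t 0 i)) ->
  (forall i, is_derive t 1 (fun x => v x 0 i) (v' t 0 i)) ->
  (forall i, is_derive t 1 (fun x => w x 0 i) (w' t 0 i)) ->
  is_derive t 1 (fun x => det3 (u x) (v x) (w x))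
    (det3 (u' t) (v t) (w t) + det3 (u t) (v' t) (w t) + det3 (u t) (v t) (w' t)).
Proof.
move=> hu hv hw; apply: is_derive_eq; rewrite /GRing.scale /det3/=; ring.
Qed.

Lemma is_derive_dot3 (R : realType) (u v u' v' : R -> 'rV[R]_3) (t : R) :
  (forall i, is_derive t 1 (fun x => u x 0 i) (u' t 0 i)) ->
  (forall i, is_derive t 1 (fun x => v x 0 i) (v' t 0 i)) ->
  is_derive t 1 (fun x => dot (u x) (v x)) (dot (u' t) (v t) + dot (u t) (v' t)).
Proof.
move=> hu hv; under eq_fun do rewrite dot3E.
by apply: is_derive_eq; rewrite /GRing.scale !dot3E/=; ring.
Qed.

Lemma curve_derive_cst (R : realType) (t : R) (u : 'rV[R]_3) i :
  is_derive t 1 (fun x : R => (fun _ => u) x 0 i) ((fun _ : R => (0 : 'rV[R]_3)) t 0 i).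
Proof. by rewrite mxE; exact: is_derive_cst. Qed.

Lemma is_derive_continuous (R : realType) (f f' : R -> R) :
  (forall t : R, is_derive t 1 f (f' t)) -> continuous f.
Proof.
move=> h t; apply: differentiable_continuous; apply/derivable1_diffP.
by have [] := h t.
Qed.

Lemma continuous_det3 (R : realType) (T : topologicalType) (u v w : T -> 'rV[R]_3)
    (x : T) :
  (forall i, {for x, continuous (fun y => u y 0 i)}) ->
  (forall i, {for x, continuous (fun y => v y 0 i)}) ->
  (forall i, {for x, continuous (fun y => w y 0 i)}) ->
  {for x, continuous (fun y => det3 (u y) (v y) (w y))}.
Proof.
move=> hu hv hw; rewrite /det3.
by apply: cvgD; [apply: cvgB|]; (apply: cvgM; [exact: hu|apply: cvgB]);
  apply: cvgM; (exact: hv || exact: hw).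
Qed.

Lemma cramer3 (R : realType) (u v w x : 'rV[R]_3) : det3 u v w != 0 ->
  x = (det3 x v w / det3 u v w) *: u + (det3 u x w / det3 u v w) *: v
      + (det3 u v x / det3 u v w) *: w.
Proof.
set W := det3 u v w => W0.
have K i : W * x 0 i = det3 x v w * u 0 i + det3 u x w * v 0 i + det3 u v x * w 0 i ->
    x 0 i = ((det3 x v w / W) *: u + (det3 u x w / W) *: v
      + (det3 u v x / W) *: w) 0 i.
  by move=> H; rewrite !mxE; apply: (mulfI W0); rewrite H; field.
by apply: row3P; apply: K; rewrite /W /det3; ring.
Qed.

Lemma mvt (R : realType) (f f1 : R -> R) (a b : R) :
  (forall t, is_derive (t : R) 1 f (f1 t)) -> a < b ->
  exists2 c, a < c < b & f b - f a = f1 c * (b - a).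
Proof.
move=> h ab.
have [c] := MVT ab (fun t _ => h t) (continuous_subspaceT (is_derive_continuous h)).
by rewrite in_itv/=; exists c.
Qed.

Lemma gt0_second_derive (R : realType) (f f1 f2 : R -> R) (r d : R) :
  (forall t, is_derive (t : R) 1 f (f1 t)) ->
  (forall t, is_derive (t : R) 1 f1 (f2 t)) -> f r = 0 -> f1 r = 0 ->
  (forall x, `|x - r| < d -> 0 < f2 x) -> forall x, 0 < `|x - r| < d -> 0 < f x.
Proof.
move=> h1 h2 fr f1r f2p x; have [xr|xr] := ger0P (x - r) => xd.
  have [|y yx] := mvt h1 (_ : r < x); first lra.
  rewrite fr subr0 => ->; have [|z zy] := mvt h2 (_ : r < y); first lra.
  rewrite f1r subr0 => ->.
  by apply: mulr_gt0; [apply: mulr_gt0|]; [apply: f2p; rewrite gtr0_norm| |]; lra.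
have [|y yx] := mvt h1 (_ : x < r); first lra.
have [|z zy] := mvt h2 (_ : y < r); first lra.
rewrite f1r fr => E1 E2.
have f2z : 0 < f2 z by apply: f2p; rewrite ltr0_norm; lra.
have : 0 < f2 z * (r - y) by apply: mulr_gt0; lra.
have ry : f1 y < 0 -> f1 y * (r - x) < 0 by move=> h; rewrite nmulr_rlt0; lra.
by lra.
Qed.

Lemma is_derive_right_ge0 (R : realType) (f : R -> R) (t h df : R) :
  0 < h -> is_derive t 1 f df -> f t = 0 ->
  (forall x, t <= x <= t + h -> 0 <= f x) -> 0 <= df.
Proof.
move=> h0 [Dcv dfE] ft fx; rewrite leNgt; apply/negP => dfn.
have /cvgrPdist_lt Df : (fun h => h^-1 *: ((f \o shift t) h%:A - f t)) @ 0^' --> df.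
  by rewrite -dfE.
have /Df[e /= e0 He] : 0 < - df by rewrite oppr_gt0.
pose y := Num.min (e / 2) h.
have y0 : 0 < y by rewrite lt_min; lra.
have [ye yh] : y <= e / 2 /\ y <= h by split; rewrite ge_min lexx ?orbT.
have := He y; rewrite /= sub0r normrN gtr0_norm// => /(_ _ _).
have -> : y < e by lra.
rewrite gt_eqF// => /(_ isT isT).
rewrite [_%:A]mulr1 ft subr0 ltr_norml => /andP[+ _].
suff : 0 <= y^-1 *: f (y + t) by lra.
by rewrite mulr_ge0// ?invr_ge0 ?(ltW y0)// fx//; lra.
Qed.

Lemma is_derive_left_le0 (R : realType) (f : R -> R) (t h df : R) :
  0 < h -> is_derive t 1 f df -> f t = 0 ->
  (forall x, t - h <= x <= t -> 0 <= f x) -> df <= 0.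
Proof.
move=> h0 Df ft fx; rewrite -oppr_ge0.
apply: (@is_derive_right_ge0 R (fun x => f (- x)) (- t) h) => //.
- by apply: is_derive_opp_arg; rewrite opprK.
- by rewrite opprK.
- by move=> x xt; apply: fx; lra.
Qed.

Lemma is_derive_min0 (R : realType) (f : R -> R) (t h df : R) :
  0 < h -> is_derive t 1 f df -> f t = 0 ->
  (forall x, `|x - t| < h -> 0 <= f x) -> df = 0.
Proof.
move=> h0 Df ft fx; apply/eqP; rewrite eq_le; apply/andP; split.
- apply: (@is_derive_left_le0 R f t (h / 2) df) => //; first lra.
  by move=> x xt; apply: fx; rewrite ltr_norml; lra.
- apply: (@is_derive_right_ge0 R f t (h / 2) df) => //; first lra.
  by move=> x xt; apply: fx; rewrite ltr_norml; lra.
Qed.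

(** The tube lemma over one compact period, spread by periodicity. The small variable [x] will be an
    offset from the diagonal or the scale of a spherical section. *)
Lemma periodic_tube (R : realType) (P : R) (f : R * R -> R) :
  0 < P -> (forall t x, f (t + P, x) = f (t, x)) ->
  (forall t, {for (t, 0), continuous f}) -> (forall t, 0 < f (t, 0)) ->
  exists2 d, 0 < d & forall t x, `|x| < d -> 0 < f (t, x).
Proof.
move=> P0 fP cf fp.
have /compact_near_coveringP nc := @segment_compact R 0 P.
have [|d /= d0 Hd] := nc R (nbhs (0 : R)) (fun x t => 0 < f (t, x)) _.
  move=> t _; have /cvgrPdist_lt/(_ _ (fp t)) := cf t.
  case=> -[A B] /= [At B0] AB; exists (A, B) => // -[y z] /= [Ay Bz].
  by have := AB (y, z) (conj Ay Bz); rewrite /= ltr_norml; lra.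
exists d => // t x xd; have [k k1] := eqmod_itv 0 t P0.
have <- : f (t + P * k%:~R, x) = f (t, x).
  exact: (@periodicZ _ _ P (fun t => f (t, x)) (fun t => fP t x)).
apply: Hd; first by rewrite /= sub0r normrN.
by rewrite /= in_itv/=; lra.
Qed.

Lemma periodic_min (R : realType) (P : R) (f : R -> R) :
  0 < P -> (forall t, f (t + P) = f t) -> continuous f -> (forall t, 0 < f t) ->
  exists2 m, 0 < m & forall t, m <= f t.
Proof.
move=> P0 fP cf fp.
have [c _ cmin] := EVT_min (ltW P0) (continuous_subspaceT cf).
exists (f c) => // t.
have [k k1] := eqmod_itv 0 t P0; rewrite -(periodicZ fP t k) cmin//.
by rewrite in_itv/=; lra.
Qed.

(** * Closed curves of class C^2 and their tangent planes *)

(** Derivatives are explicit functions, so that the spherical sections below can be given by closed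
    formulas; order two is what local convexity depends on. *)
Record closed_C2_curve (R : realType) (P : R) (c c1 c2 : R -> 'rV[R]_3) : Prop :=
  ClosedC2Curve {
    cc_derive : curve_derive c c1;
    cc_derive2 : curve_derive c1 c2;
    cc_cont2 : forall i, continuous (fun t => c2 t 0 i);
    cc_period : forall t, c (t + P) = c t }.

Lemma curve_derive_continuous (R : realType) (c c' : R -> 'rV[R]_3) i :
  curve_derive c c' -> continuous (fun t => c t 0 i).
Proof. by move=> h; apply: (@is_derive_continuous _ _ (fun t => c' t 0 i)) => t; exact: h. Qed.

Lemma curve_derive_periodic (R : realType) (P : R) (c c' : R -> 'rV[R]_3) :
  curve_derive c c' -> (forall t, c (t + P) = c t) -> forall t, c' (t + P) = c' t.
Proof.
move=> h cP t; apply/rowP => i; have h1 : is_derive (P + t) 1 (fun x => c x 0 i) (c' (t + P) 0 i).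
  by rewrite addrC; exact: h.
apply: (is_derive_uniq _ (h t i)); have := is_derive_shiftl h1.
by under eq_fun do rewrite addrC cP.
Qed.

Lemma cc_period1 (R : realType) (P : R) (c c1 c2 : R -> 'rV[R]_3) :
  closed_C2_curve P c c1 c2 -> forall t, c1 (t + P) = c1 t.
Proof. by move=> cc; exact: curve_derive_periodic (cc_derive cc) (cc_period cc). Qed.

Lemma cc_period2 (R : realType) (P : R) (c c1 c2 : R -> 'rV[R]_3) :
  closed_C2_curve P c c1 c2 -> forall t, c2 (t + P) = c2 t.
Proof. by move=> cc; exact: curve_derive_periodic (cc_derive2 cc) (cc_period1 cc). Qed.

Lemma det3Z (R : realType) (u v w : 'rV[R]_3) (k : R) :
  det3 u v (k *: w) = k * det3 u v w.
Proof. by rewrite /det3 !mxE; ring. Qed.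

Lemma det3D (R : realType) (u v w x : 'rV[R]_3) :
  det3 u v (w + x) = det3 u v w + det3 u v x.
Proof. by rewrite /det3 !mxE; ring. Qed.

Lemma det3_aba (R : realType) (u v : 'rV[R]_3) : det3 u v u = 0.
Proof. by rewrite /det3; ring. Qed.

Lemma det3_abb (R : realType) (u v : 'rV[R]_3) : det3 u v v = 0.
Proof. by rewrite /det3; ring. Qed.

Lemma det3_aab (R : realType) (u v : 'rV[R]_3) : det3 u u v = 0.
Proof. by rewrite /det3; ring. Qed.

Lemma det3_0l (R : realType) (u v : 'rV[R]_3) : det3 0 u v = 0.
Proof. by rewrite /det3 !mxE; ring. Qed.

Lemma det3_0m (R : realType) (u v : 'rV[R]_3) : det3 u 0 v = 0.
Proof. by rewrite /det3 !mxE; ring. Qed.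

Lemma det3_0r (R : realType) (u v : 'rV[R]_3) : det3 u v 0 = 0.
Proof. by rewrite /det3 !mxE; ring. Qed.

Section TangentOfCurve.
Variables (R : realType) (P : R) (c c1 c2 : R -> 'rV[R]_3).
Hypotheses (P0 : 0 < P) (cc : closed_C2_curve P c c1 c2).
Hypothesis W0 : forall t, 0 < det3 (c t) (c1 t) (c2 t).
Let g r e := det3 (c r) (c1 r) (c e).

Lemma is_derive_chordr r (e : R) : is_derive e 1 (g r) (det3 (c r) (c1 r) (c1 e)).
Proof.
have := @is_derive_det3 R _ _ c _ _ c1 e (curve_derive_cst e (c r))
  (curve_derive_cst e (c1 r)) (cc_derive cc e).
by rewrite /= det3_0l det3_0m !add0r.
Qed.

Lemma is_derive_chordl e (r : R) : is_derive r 1 (g^~ e) (det3 (c r) (c2 r) (c e)).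
Proof.
have := @is_derive_det3 R c c1 _ c1 c2 _ r (cc_derive cc r) (cc_derive2 cc r)
  (curve_derive_cst r (c e)).
by rewrite det3_aab add0r /= det3_0r addr0.
Qed.

(** At [e = r] both [g r] and its derivative vanish, while its second derivative is the positive
    Wronskian; the tube lemma makes the radius independent of [r]. *)
Lemma chord_near : exists2 d, 0 < d & forall r e, 0 < `|e - r| < d -> 0 < g r e.
Proof.
have [||t|d d0 Hd] := @periodic_tube R P
    (fun p => det3 (c p.1) (c1 p.1) (c2 (p.1 + p.2))) P0.
- by move=> t x /=; rewrite (cc_period cc) (cc_period1 cc) addrAC (cc_period2 cc).
- move=> t; apply: continuous_det3 => i.
  + apply: (@continuous_comp _ _ _ fst (fun y => c y 0 i)); first exact: cvg_fst.
    exact: (curve_derive_continuous (cc_derive cc)).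
  + apply: (@continuous_comp _ _ _ fst (fun y => c1 y 0 i)); first exact: cvg_fst.
    exact: (curve_derive_continuous (cc_derive2 cc)).
  + apply: (@continuous_comp _ _ _ (fun p : R * R => p.1 + p.2) (fun y => c2 y 0 i)).
      by apply: cvgD; [exact: cvg_fst | exact: cvg_snd].
    exact: (cc_cont2 cc).
- by rewrite /= addr0.
exists d => // r e er.
apply: (@gt0_second_derive R (g r) (fun x => det3 (c r) (c1 r) (c1 x))
  (fun x => det3 (c r) (c1 r) (c2 x)) r d _ _ _ _ _ e er).
- exact: is_derive_chordr.
- move=> t.
  have := @is_derive_det3 R _ _ c1 _ _ c2 t (curve_derive_cst t (c r))
    (curve_derive_cst t (c1 r)) (cc_derive2 cc t).
  by rewrite /= det3_0l det3_0m !add0r.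
- exact: det3_aba.
- exact: det3_abb.
- by move=> x xr; have := Hd r (x - r) xr; rewrite /= addrCA subrr addr0.
Qed.

Lemma chord_cont : continuous (fun p : R * R => g p.1 p.2).
Proof.
move=> p; apply: continuous_det3 => i.
- apply: (@continuous_comp _ _ _ fst (fun y => c y 0 i)); first exact: cvg_fst.
  exact: (curve_derive_continuous (cc_derive cc)).
- apply: (@continuous_comp _ _ _ fst (fun y => c1 y 0 i)); first exact: cvg_fst.
  exact: (curve_derive_continuous (cc_derive2 cc)).
- apply: (@continuous_comp _ _ _ snd (fun y => c y 0 i)); first exact: cvg_snd.
  exact: (curve_derive_continuous (cc_derive cc)).
Qed.

Hypothesis ray : forall r e x, 0 < x -> c e = x *: c r -> eqmod P e r.

Lemma curve_neq0 t : c t != 0.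
Proof.
by apply/eqP => ct; have := W0 t; rewrite ct /det3 !mxE !mul0r !subrr add0r ltxx.
Qed.

(** A tangent plane with [c r] strictly and [c e] weakly on its positive side rules out a negative
    factor, and [c e] is not zero; so both points lie on one ray. *)
Lemma parallel_eqmod r e x : c e = x *: c r ->
  (exists2 y, 0 <= g y e & 0 < g y r) -> eqmod P e r.
Proof.
move=> ce [y ye yr]; have [x0|x0] := ltP 0 x; first exact: ray ce.
have xn : x != 0 by apply: contra_neq (curve_neq0 e) => x0'; rewrite ce x0' scale0r.
have : x * g y r < 0 by rewrite nmulr_rlt0// lt_neqAle xn.
by move: ye; rewrite /g ce det3Z; lra.
Qed.

(** Cramer's rule in the basis [c r], [c1 r], [c2 r], whose last coefficient is a multiple of
    [g r e]. The coefficient of [c1 r] is minus the derivative of [g^~ e] at [r], divided by the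
    Wronskian: the sign of that derivative tells on which side of [c r] within the plane [c e]
    lies. *)
Lemma tangent_span r e : g r e = 0 ->
  c e = (det3 (c e) (c1 r) (c2 r) / det3 (c r) (c1 r) (c2 r)) *: c r
        + (- det3 (c r) (c2 r) (c e) / det3 (c r) (c1 r) (c2 r)) *: c1 r.
Proof.
move=> ge; rewrite [LHS](@cramer3 R (c r) (c1 r) (c2 r)); last by rewrite gt_eqF.
rewrite -/(g r e) ge mul0r scale0r addr0; congr (_ + (_ / _) *: _).
by rewrite /det3; ring.
Qed.

Lemma tangent_function_curve : tangent_function P g.
Proof.
split.
- by move=> r e; rewrite /g (cc_period cc) (cc_period1 cc).
- by move=> r e; rewrite /g (cc_period cc).
- exact: chord_cont.
- exact: chord_near.
- move=> r e h h0 ge Hx; have d0 := is_derive_min0 h0 (is_derive_chordl e r) ge Hx.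
  have := tangent_span ge; rewrite d0 oppr0 mul0r scale0r addr0 => ce.
  apply: (parallel_eqmod ce).
  have [d dp Hd] := chord_near.
  have m0 : 0 < Num.min h d by rewrite lt_min h0.
  have [mh md] : Num.min h d <= h /\ Num.min h d <= d by split; rewrite ge_min lexx ?orbT.
  (* Within [h] of [r] for the weak sign at [e], within [d] of [r] for the strict sign at [r]. *)
  exists (r - Num.min h d / 2).
    by apply: Hx; rewrite ltr_norml; lra.
  by apply: Hd; rewrite gtr0_norm; lra.
- move=> s t e h h0 gst Hs gte He.
  (* In [g s e] the part of [c e] along [c t] drops out because [g s t = 0]. The coefficient along
     [c1 t] is nonpositive by [d2], and the determinant that it multiplies is nonnegative by
     [d1]. *)
  have d1 := is_derive_right_ge0 h0 (is_derive_chordr s t) gst Hs.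
  have d2 := is_derive_right_ge0 h0 (is_derive_chordl e t) gte He.
  rewrite /g (tangent_span gte) det3D !det3Z -/(g s t) gst mulr0 add0r.
  by rewrite mulr_le0_ge0// mulNr oppr_le0 divr_ge0// ltW.
- move=> s t e h h0 gst Hs gte He.
  have d1 := is_derive_left_le0 h0 (is_derive_chordr s t) gst Hs.
  have d2 := is_derive_left_le0 h0 (is_derive_chordl e t) gte He.
  rewrite /g (tangent_span gte) det3D !det3Z -/(g s t) gst mulr0 add0r.
  by rewrite mulr_ge0_le0// divr_ge0 ?oppr_ge0// ltW.
- move=> s t u gts gst gus gut Hx; apply: contrapT => st.
  (* The derivative of [g (t + x) (s + x)] at its minimum [x = 0]. Its second term vanishes ([g1]),
     because the plane at [t] contains [c t] and [c s], hence [c1 s]; the vanishing of the first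
     term then makes [c s] parallel to [c t]. *)
  have dd : det3 (c t) (c2 t) (c s) + det3 (c t) (c1 t) (c1 s) = 0.
    have sh (f f' : R -> 'rV[R]_3) a : curve_derive f f' -> forall i,
        is_derive (0 : R) 1 (fun x => f (a + x) 0 i) (f' (a + 0) 0 i).
      by move=> ff' i; exact: (@is_derive_shiftl R (fun y => f y 0 i) a 0 _ (ff' (a + 0) i)).
    have := @is_derive_det3 R (fun x => c (t + x)) (fun x => c1 (t + x))
      (fun x => c (s + x)) (fun x => c1 (t + x)) (fun x => c2 (t + x))
      (fun x => c1 (s + x)) 0 (sh _ _ t (cc_derive cc)) (sh _ _ t (cc_derive2 cc))
      (sh _ _ s (cc_derive cc)).
    rewrite !addr0 det3_aab add0r => D.
    apply: (is_derive_min0 ltr01 D) => [|x _]; last exact: Hx.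
    by rewrite !addr0.
  have ct := tangent_span gst; set x := _ / _ in ct; set y := _ / _ in ct.
  have y0 : y != 0.
    apply/eqP => y0; apply: st; apply: eqmod_sym; apply: (@parallel_eqmod s t x).
      by rewrite [LHS]ct y0 scale0r addr0.
    by exists u => //; exact: ltW.
  have g1 : det3 (c t) (c1 t) (c1 s) = 0.
    have := det3_aba (c t) (c1 t); rewrite [X in det3 _ _ X]ct det3D !det3Z.
    rewrite -/(g t s) gts mulr0 add0r => /eqP.
    by rewrite mulf_eq0 (negPf y0) => /eqP.
  apply: st; move: dd; rewrite g1 addr0 => dd.
  have := tangent_span gts; rewrite dd oppr0 mul0r scale0r addr0 => cs.
  by apply: (parallel_eqmod cs); exists u => //; exact: ltW.
Qed.

Lemma chord_gt0 r e : ~ eqmod P e r -> 0 < det3 (c r) (c1 r) (c e).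
Proof. exact: (tangent_function_gt0 P0 tangent_function_curve). Qed.

End TangentOfCurve.

(** * From embedded ends to simple rulings *)

(** Projected from [c p], the curve has slope [D / y] relative to the direction of [c t2]. This
    slope vanishes at [t2] and increases: a Plücker relation gives its derivative as [y t2 * det3 (c
    t) (c1 t) (c p) / y t ^+ 2]. *)
Lemma triple_gt0 (R : realType) (c c1 : R -> 'rV[R]_3) (p t2 t3 : R) :
  curve_derive c c1 -> p < t2 -> t2 < t3 ->
  (forall t, p < t <= t3 -> 0 < det3 (c p) (c1 p) (c t)) ->
  (forall t, p < t <= t3 -> 0 < det3 (c t) (c1 t) (c p)) ->
  0 < det3 (c p) (c t2) (c t3).
Proof.
move=> cd pt2 t23 gp gt.
pose y t := det3 (c p) (c1 p) (c t); pose D t := det3 (c p) (c t2) (c t).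
have dlin u v (t : R) : is_derive t 1 (fun x => det3 u v (c x)) (det3 u v (c1 t)).
  have := @is_derive_det3 R _ _ c _ _ c1 t (curve_derive_cst t u)
    (curve_derive_cst t v) (cd t).
  by rewrite /= det3_0l det3_0m !add0r.
have dq t : t2 <= t <= t3 ->
    is_derive t 1 (fun x => D x * (y x)^-1) (y t2 * det3 (c t) (c1 t) (c p) / y t ^+ 2).
  move=> t23'; have yt : y t != 0 by rewrite gt_eqF// gp//; lra.
  have [dy dyE] := dlin (c p) (c1 p) t.
  have hV : is_derive t 1 (fun x => (y x)^-1) (- (y t) ^- 2 * det3 (c p) (c1 p) (c1 t)).
    by apply: DeriveDef; [exact: derivableV | rewrite deriveV// dyE].
  have hD : is_derive t 1 D (det3 (c p) (c t2) (c1 t)) by exact: dlin.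
  apply: is_derive_eq; rewrite /GRing.scale/=.
  have -> : y t2 * det3 (c t) (c1 t) (c p) =
      det3 (c p) (c t2) (c1 t) * y t - D t * det3 (c p) (c1 p) (c1 t).
    by rewrite /y /D /det3; ring.
  by field.
have [||z] := @MVT R (fun x => D x * (y x)^-1)
   (fun t => y t2 * det3 (c t) (c1 t) (c p) / y t ^+ 2) t2 t3 t23.
- by move=> x; rewrite in_itv/= => xt; apply: dq; lra.
- apply: derivable_within_continuous => x; rewrite in_itv/= => xt.
  by have [] := dq x xt.
rewrite in_itv/= => zt; rewrite /D det3_abb mul0r subr0 => E.
have y3 : 0 < y t3 by apply: gp; lra.
have : 0 < D t3 * (y t3)^-1.
  rewrite E; apply: mulr_gt0; last lra.
  apply: divr_gt0; last by rewrite exprn_gt0// gp//; lra.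
  by apply: mulr_gt0; [apply: gp|apply: gt]; lra.
by rewrite pmulr_lgt0// invr_gt0.
Qed.

(* The point of the ruling at time [t] at distance [1 / k] from the origin,
   rescaled by [k] onto the unit sphere, is [c k t = k *: s t + w k t *: x t]. *)
Section SphericalSection.
Variables (R : realType) (P : R) (s s1 s2 x x1 x2 : R -> 'rV[R]_3).
Hypotheses (P0 : 0 < P) (cs : closed_C2_curve P s s1 s2) (cx : closed_C2_curve P x x1 x2).
Hypothesis x_unit : forall t, dot (x t) (x t) = 1.

Let b t := dot (s t) (x t).
Let b1 t := dot (s1 t) (x t) + dot (s t) (x1 t).
Let b2 t := dot (s2 t) (x t) + dot (s1 t) (x1 t) + (dot (s1 t) (x1 t) + dot (s t) (x2 t)).
Let p t := dot (s t) (s t) - b t * b t.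
Let p1 t := 2 * (dot (s1 t) (s t) - b t * b1 t).
Let p2 t := 2 * (dot (s2 t) (s t) + dot (s1 t) (s1 t) - b1 t * b1 t - b t * b2 t).
Let q k t := 1 - k * k * p t.
Let r k t := Num.sqrt (q k t).
(** Completing the square in the equation of the unit sphere for [k *: s t + w *: x t] gives
    [(w + k * b t) ^+ 2 = q k t]; this is the root that tends to 1 as [k] tends to 0. [w1] and [w2]
    are its derivatives in [t]. *)
Let w k t := r k t - k * b t.
Let w1 k t := - (k * k * p1 t / (2 * r k t)) - k * b1 t.
Let w2 k t := - (k * k * p2 t / (2 * r k t))
  - k * k * k * k * (p1 t * p1 t) / (4 * (r k t * r k t * r k t)) - k * b2 t.
Let c k t := k *: s t + w k t *: x t.
Let c1 k t := k *: s1 t + (w1 k t *: x t + w k t *: x1 t).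
Let c2 k t := k *: s2 t + (w2 k t *: x t + (2 * w1 k t) *: x1 t + w k t *: x2 t).

Lemma section_unit k t : 0 < q k t -> dot (c k t) (c k t) = 1.
Proof.
move=> qt; have rr : r k t ^+ 2 = q k t by rewrite sqr_sqrtr// ltW.
have -> : dot (c k t) (c k t) =
  k ^+ 2 * dot (s t) (s t) + 2 * k * w k t * b t + w k t ^+ 2 * dot (x t) (x t).
  by rewrite /b /c !dot3E !mxE; ring.
rewrite x_unit mulr1.
have -> : k ^+ 2 * dot (s t) (s t) + 2 * k * w k t * b t + w k t ^+ 2 =
  r k t ^+ 2 + k ^+ 2 * (dot (s t) (s t) - b t * b t) by rewrite /w; ring.
by rewrite rr /q /p; ring.
Qed.

Let db (t : R) : is_derive t 1 b (b1 t).
Proof. exact: (is_derive_dot3 (cc_derive cs t) (cc_derive cx t)). Qed.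

Let db1 (t : R) : is_derive t 1 b1 (b2 t).
Proof.
have h1 := is_derive_dot3 (cc_derive2 cs t) (cc_derive cx t).
have h2 := is_derive_dot3 (cc_derive cs t) (cc_derive2 cx t).
exact: is_deriveD.
Qed.

Let dp (t : R) : is_derive t 1 p (p1 t).
Proof.
have h1 := is_derive_dot3 (cc_derive cs t) (cc_derive cs t).
have h2 := db t.
apply: is_derive_eq; rewrite /GRing.scale/= /p1 (_ : dot (s t) (s1 t) = dot (s1 t) (s t)).
  by ring.
by rewrite !dot3E; ring.
Qed.

Let dp1 (t : R) : is_derive t 1 p1 (p2 t).
Proof.
have h1 := is_derive_dot3 (cc_derive2 cs t) (cc_derive cs t).
have h2 := db t; have h3 := db1 t.
by apply: is_derive_eq; rewrite /GRing.scale/= /p2; ring.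
Qed.

Let dr k (t : R) : 0 < q k t -> is_derive t 1 (r k) (- (k * k * p1 t / (2 * r k t))).
Proof.
move=> qt; have h1 := dp t.
have hq : is_derive t 1 (q k) (- (k * k * p1 t)).
  by apply: is_derive_eq; rewrite /GRing.scale/=; ring.
have := is_derive1_comp (is_derive1_sqrt qt) hq.
by rewrite mulrC mulNr.
Qed.

Let dw k (t : R) : 0 < q k t -> is_derive t 1 (w k) (w1 k t).
Proof.
move=> qt; have h1 := dr qt; have h2 := db t.
by apply: is_derive_eq; rewrite /GRing.scale/= /w1; ring.
Qed.

Let dw1 k (t : R) : 0 < q k t -> is_derive t 1 (w1 k) (w2 k t).
Proof.
move=> qt; have [dR dRE] := dr qt; have h2 := db1 t; have h3 := dp1 t.
have r0 : r k t != 0 by rewrite gt_eqF// sqrtr_gt0.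
have hV : is_derive t 1 (fun y => (r k y)^-1) (- (r k t) ^- 2 * (- (k * k * p1 t / (2 * r k t)))).
  by apply: DeriveDef; [exact: derivableV | rewrite deriveV// dRE].
have -> : w1 k = (fun t => - (k * k / 2 * p1 t * (r k t)^-1) - k * b1 t).
  by apply/funext => y; rewrite /w1 invfM; ring.
by apply: is_derive_eq; rewrite /GRing.scale/= /w2; field.
Qed.

Let continuous_dot (u v : R -> 'rV[R]_3) :
  (forall i, continuous (fun t => u t 0 i)) ->
  (forall i, continuous (fun t => v t 0 i)) -> continuous (fun t => dot (u t) (v t)).
Proof.
move=> cu cv t; under eq_fun do rewrite dot3E.
by apply: cvgD; [apply: cvgD|]; (apply: cvgM; [exact: cu | exact: cv]).
Qed.

Let cs0 i := curve_derive_continuous (i:=i) (cc_derive cs).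
Let cs1 i := curve_derive_continuous (i:=i) (cc_derive2 cs).
Let cs2 := cc_cont2 cs.
Let cx0 i := curve_derive_continuous (i:=i) (cc_derive cx).
Let cx1 i := curve_derive_continuous (i:=i) (cc_derive2 cx).
Let cx2 := cc_cont2 cx.

Let cb : continuous b. Proof. exact: is_derive_continuous db. Qed.
Let cb1 : continuous b1. Proof. exact: is_derive_continuous db1. Qed.
Let cp : continuous p. Proof. exact: is_derive_continuous dp. Qed.
Let cp1 : continuous p1. Proof. exact: is_derive_continuous dp1. Qed.
Let cb2 : continuous b2.
Proof.
move=> t; apply: cvgD; apply: cvgD.
- by apply: continuous_dot; [exact: cs2 | exact: cx0].
- by apply: continuous_dot; [exact: cs1 | exact: cx1].
- by apply: continuous_dot; [exact: cs1 | exact: cx1].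
- by apply: continuous_dot; [exact: cs0 | exact: cx2].
Qed.
Let cp2 : continuous p2.
Proof.
move=> t; apply: cvgM; first exact: cvg_cst.
apply: cvgB; last by apply: cvgM; [exact: cb|exact: cb2].
apply: cvgB; last by apply: cvgM; exact: cb1.
by apply: cvgD; apply: continuous_dot;
  [exact: cs2 | exact: cs0 | exact: cs1 | exact: cs1].
Qed.

Let on_fst (f : R -> R) (y : R * R) : continuous f -> {for y, continuous (fun y => f y.1)}.
Proof. by move=> cf; apply: continuous_comp; [exact: cvg_fst | exact: cf]. Qed.

Let ck (y : R * R) : {for y, continuous (fun y : R * R => y.2)}.
Proof. exact: cvg_snd. Qed.

Let cr y : {for y, continuous (fun y => r y.2 y.1)}.
Proof.
apply: (@continuous_comp _ _ _ (fun y => q y.2 y.1) Num.sqrt).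
  apply: cvgB; first exact: cvg_cst.
  apply: cvgM; last exact: on_fst cp.
  by apply: cvgM; exact: ck.
exact: sqrt_continuous.
Qed.

Let cw y : {for y, continuous (fun y => w y.2 y.1)}.
Proof. by apply: cvgB; [exact: cr | apply: cvgM; [exact: ck | exact: on_fst cb]]. Qed.

Let cw1 y : r y.2 y.1 != 0 -> {for y, continuous (fun y => w1 y.2 y.1)}.
Proof.
move=> r0; apply: cvgB; last by apply: cvgM; [exact: ck | exact: on_fst cb1].
apply: cvgN; apply: cvgM.
  by apply: cvgM; [apply: cvgM; exact: ck | exact: on_fst cp1].
apply: cvgV; first by rewrite mulf_neq0.
by apply: cvgM; [exact: cvg_cst | exact: cr].
Qed.

Let cw2 y : r y.2 y.1 != 0 -> {for y, continuous (fun y => w2 y.2 y.1)}.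
Proof.
move=> r0; apply: cvgB; last by apply: cvgM; [exact: ck | exact: on_fst cb2].
apply: cvgB.
  apply: cvgN; apply: cvgM.
    by apply: cvgM; [apply: cvgM; exact: ck | exact: on_fst cp2].
  apply: cvgV; first by rewrite mulf_neq0.
  by apply: cvgM; [exact: cvg_cst | exact: cr].
apply: cvgM.
  apply: cvgM; last by apply: cvgM; exact: on_fst cp1.
  by apply: cvgM; [apply: cvgM; [apply: cvgM|]|]; exact: ck.
apply: cvgV; first by rewrite !mulf_neq0.
by apply: cvgM; [exact: cvg_cst | apply: cvgM; [apply: cvgM|]; exact: cr].
Qed.

Let eq_for (f g : R * R -> R) y :
  f =1 g -> {for y, continuous g} -> {for y, continuous f}.
Proof. by move/funext ->. Qed.

Let cc0 i y : {for y, continuous (fun y => c y.2 y.1 0 i)}.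
Proof.
apply: eq_for; first by move=> z; rewrite !mxE; reflexivity.
apply: cvgD; apply: cvgM; [exact: ck | exact: on_fst (@cs0 i) | exact: cw | exact: on_fst (@cx0 i)].
Qed.

Let cc1 i y : r y.2 y.1 != 0 -> {for y, continuous (fun y => c1 y.2 y.1 0 i)}.
Proof.
move=> r0; apply: eq_for; first by move=> z; rewrite !mxE; reflexivity.
apply: cvgD; first by apply: cvgM; [exact: ck | exact: on_fst (@cs1 i)].
apply: cvgD; apply: cvgM; [exact: cw1 | exact: on_fst (@cx0 i) | exact: cw | exact: on_fst (@cx1 i)].
Qed.

Let cc2 i y : r y.2 y.1 != 0 -> {for y, continuous (fun y => c2 y.2 y.1 0 i)}.
Proof.
move=> r0; apply: eq_for; first by move=> z; rewrite !mxE; reflexivity.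
apply: cvgD; first by apply: cvgM; [exact: ck | exact: on_fst (@cs2 i)].
apply: cvgD; last by apply: cvgM; [exact: cw | exact: on_fst (@cx2 i)].
apply: cvgD; apply: cvgM; [exact: cw2 | exact: on_fst (@cx0 i) | | exact: on_fst (@cx1 i)].
by apply: cvgM; [exact: cvg_cst | exact: cw1].
Qed.

Lemma section_closed_C2 k : (forall t, 0 < q k t) ->
  closed_C2_curve P (c k) (c1 k) (c2 k).
Proof.
move=> q0; split.
- move=> t i; have h1 := dw (q0 t); have h2 := cc_derive cx t i.
  have h3 := cc_derive cs t i.
  under eq_fun do rewrite !mxE.
  by apply: is_derive_eq; rewrite /GRing.scale !mxE/=; ring.
- move=> t i; have h1 := dw (q0 t); have h2 := cc_derive cx t i.
  have h3 := cc_derive2 cs t i; have h4 := dw1 (q0 t); have h5 := cc_derive2 cx t i.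
  under eq_fun do rewrite !mxE.
  by apply: is_derive_eq; rewrite /GRing.scale !mxE/=; ring.
- move=> i t; apply: (@continuous_comp _ _ _ (fun t => (t, k)) (fun y : R * R => c2 y.2 y.1 0 i)).
    by apply: continuous_pair; [exact: cvg_id | exact: cvg_cst].
  by apply: cc2; rewrite gt_eqF//= sqrtr_gt0.
- move=> t; rewrite /c /w /r /q /p /b.
  by rewrite !(cc_period cs) !(cc_period cx).
Qed.

Let r0 t : r 0 t = 1.
Proof. by rewrite /r /q !mul0r subr0 sqrtr1. Qed.

(** Rescaling has removed the singularity at infinity: [k = 0] is an ordinary parameter, at which
    the family and its derivatives in [t] are continuous. *)
Let c_0 t : c 0 t = x t.
Proof. by rewrite /c /w r0 mul0r subr0 scale0r scale1r add0r. Qed.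

Let c1_0 t : c1 0 t = x1 t.
Proof.
by rewrite /c1 /w1 /w r0 !mul0r oppr0 !addr0 !scale0r scale1r !add0r.
Qed.

Let c2_0 t : c2 0 t = x2 t.
Proof.
by rewrite /c2 /w2 /w1 /w r0 !mul0r oppr0 !addr0 mulr0 !scale0r scale1r !add0r.
Qed.

(* The sections [c k] are simple and tend to [x] in C^2 as [k] tends to 0, so
   they are convex for small [k] and three of their points in cyclic order are
   positively oriented.  A double point of [x] violates this in the limit. *)
Lemma simple_of_ruled_embedding (v0 : R) :
  (forall t, 0 < det3 (x t) (x1 t) (x2 t)) ->
  (forall t1 t2 v1 v2, v0 <= v1 -> v0 <= v2 ->
    s t1 + v1 *: x t1 = s t2 + v2 *: x t2 -> eqmod P t1 t2) ->
  forall t1 t2, x t1 = x t2 -> eqmod P t1 t2.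
Proof.
move=> W0 inj t1 t2 x12; apply: contrapT => t12.
have [m m1] := eqmod_itv t1 t2 P0; set u := t2 + _ in m1.
have xu : x u = x t1 by rewrite x12 (periodicZ (cc_period cx)).
have ut : t1 < u < t1 + P.
  rewrite lt_neqAle; apply/andP; split; last lra.
  apply/andP; split; last lra.
  by apply/eqP => tu; apply: t12; exists m.
have [d d0 near] := chord_near P0 cx W0.
(* Small enough that the arc from [t1 - h] to [t1 + h] is shorter than [d] and that [u] stays
   outside it modulo [P]. *)
pose h := Num.min (d / 2) (Num.min (u - t1) (t1 + P - u)) / 2.
have h0 : 0 < h by rewrite divr_gt0// !lt_min; lra.
have [hd hu hP] : [/\ 2 * h < d, t1 + h < u & u < t1 - h + P].
  have l1 : 2 * h <= d / 2 by rewrite /h mulrC divfK// ge_min lexx.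
  have l2 : 2 * h <= u - t1 by rewrite /h mulrC divfK// !ge_min lexx orbT.
  have l3 : 2 * h <= t1 + P - u by rewrite /h mulrC divfK// !ge_min lexx !orbT.
  by split; lra.
have D0 : 0 < det3 (x (t1 - h)) (x t1) (x (t1 + h)).
  apply: (triple_gt0 (cc_derive cx)); [lra|lra| |] => t tt; apply: near.
    by rewrite gtr0_norm; lra.
  by rewrite ltr0_norm; lra.
have ord1 : t1 - h < t1 + h by lra.
have ord2 : t1 + h < u by [].
have sep t : t1 - h < t <= u -> ~ eqmod P t (t1 - h) /\ ~ eqmod P (t1 - h) t.
  by move=> tt; split; apply: eqmod_dist_lt; [rewrite gtr0_norm | rewrite ltr0_norm]; lra.
have atr (a : R) i y : {for y, continuous (fun y : R * R => c y.2 a 0 i)}.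
  apply: (@continuous_comp _ _ _ (fun y : R * R => (a, y.2)) (fun y => c y.2 y.1 0 i)).
    by apply: continuous_pair; [exact: cvg_cst | exact: cvg_snd].
  exact: cc0.
have r01 t : r (t, 0 : R).2 (t, 0 : R).1 != 0 by rewrite /= r0 oner_neq0.
have tube f := @periodic_tube R P f P0.
(* Four strict inequalities hold at [k = 0] and so for small [k]: the square root is smooth, the
   section is locally convex, the unscaled parameter [w k t / k] exceeds [v0], and the triple with
   [u] in the place of [t1] keeps the sign found in [D0]. *)
have [|t|t|e1 e1p H1] := tube (fun y => q y.2 y.1).
- by move=> t z /=; rewrite /q /p /b !(cc_period cs) !(cc_period cx).
- apply: cvgB; first exact: cvg_cst.
  by apply: cvgM; [apply: cvgM; exact: ck | exact: on_fst cp].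
- by rewrite /= /q !mul0r subr0.
have [|t|t|e2 e2p H2] := tube (fun y => det3 (c y.2 y.1) (c1 y.2 y.1) (c2 y.2 y.1)).
- move=> t z /=; rewrite /c /c1 /c2 /w2 /w1 /w /r /q /p2 /p1 /p /b2 /b1 /b.
  by rewrite !(cc_period cs, cc_period cx, cc_period1 cs, cc_period1 cx,
    cc_period2 cs, cc_period2 cx).
- by apply: continuous_det3 => i; [exact: cc0 | exact: cc1 | exact: cc2].
- by rewrite /= c_0 c1_0 c2_0.
have [|t|t|e3 e3p H3] := tube (fun y => w y.2 y.1 - v0 * y.2).
- by move=> t z /=; rewrite /w /r /q /p /b !(cc_period cs) !(cc_period cx).
- by apply: cvgB; [exact: cw | apply: cvgM; [exact: cvg_cst | exact: ck]].
- by rewrite /= /w r0 mul0r mulr0 !subr0.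
have [|t|t|e4 e4p H4] := tube (fun y => det3 (c y.2 (t1 - h)) (c y.2 u) (c y.2 (t1 + h))).
- by [].
- by apply: continuous_det3 => i; exact: atr.
- by rewrite /= !c_0 xu.
pose k := Num.min (Num.min e1 e2) (Num.min e3 e4) / 2.
have k0 : 0 < k by rewrite divr_gt0// !lt_min e1p e2p e3p e4p.
have [k1 k2 k3 k4] : [/\ `|k| < e1, `|k| < e2, `|k| < e3 & `|k| < e4].
  have lk e : Num.min (Num.min e1 e2) (Num.min e3 e4) <= e -> `|k| < e.
    rewrite gtr0_norm// => le_e; apply: lt_le_trans le_e.
    by rewrite /k ltr_pdivrMr// ltr_pMr ?ltr1n// !lt_min e1p e2p e3p e4p.
  by split; apply: lk; rewrite !ge_min lexx ?orbT.
have q0 t : 0 < q k t by exact: H1.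
have cck := section_closed_C2 q0.
(* On the unit sphere a common ray means a common point; scaled back by [k^-1] it is a coincidence
   of two points of the ruled surface with parameters at least [v0]. *)
have ray a e z : 0 < z -> c k e = z *: c k a -> eqmod P e a.
  move=> z0 ce; have z1 : z = 1.
    have := section_unit (q0 e); rewrite ce.
    have -> : dot (z *: c k a) (z *: c k a) = z ^+ 2 * dot (c k a) (c k a).
      by rewrite !dot3E !mxE; ring.
    rewrite (section_unit (q0 a)) mulr1 => /eqP; rewrite sqrf_eq1 => /orP[/eqP//|/eqP zN].
    by move: z0; rewrite zN ltr0N1.
  rewrite z1 scale1r in ce.
  have scale t : s t + (w k t / k) *: x t = k^-1 *: c k t.
    rewrite /c scalerDr !scalerA mulVf ?gt_eqF// scale1r.
    by rewrite (mulrC k^-1).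
  have big t : v0 <= w k t / k.
    by rewrite ler_pdivlMr// -subr_ge0 ltW// (H3 t k k3).
  by apply: (inj e a (w k e / k) (w k a / k)) => //; rewrite !scale ce.
have chord a e : ~ eqmod P e a -> 0 < det3 (c k a) (c1 k a) (c k e).
  by apply: (chord_gt0 P0 cck) => // t; exact: H2.
(* Here [u] comes last within one period, and convexity makes the triple positive. [H4] makes the
   triple with the last two entries exchanged positive as well. *)
have : 0 < det3 (c k (t1 - h)) (c k (t1 + h)) (c k u).
  apply: (@triple_gt0 R (c k) (c1 k) _ _ _ (cc_derive cck) ord1 ord2) => t tt;
    by apply: chord; have [] := sep t tt.
have := H4 0 k k4; rewrite /=.
have -> : det3 (c k (t1 - h)) (c k (t1 + h)) (c k u)
  = - det3 (c k (t1 - h)) (c k u) (c k (t1 + h)) by rewrite /det3; ring.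
by rewrite oppr_gt0 => /lt_trans h1 /h1; rewrite ltxx.
Qed.

End SphericalSection.

(** * From simple rulings to embedded ends *)

Lemma biperiodic_bounded (R : realType) (P : R) (f : R * R -> R) :
  0 < P -> continuous f -> (forall a b, f (a + P, b) = f (a, b)) ->
  (forall a b, f (a, b + P) = f (a, b)) -> exists2 m, 0 < m & forall p, `|f p| <= m.
Proof.
move=> P0 cf fl fr.
have cN : continuous (fun p => - `|f p|).
  by move=> p; apply: cvgN; apply: cvg_norm; exact: cf.
have cS := compact_setX (@segment_compact R 0 P) (@segment_compact R 0 P).
have S0 : `[0, P]%classic `*` `[0, P]%classic !=set0.
  by exists (0, 0); split; rewrite /= in_itv/=; lra.
have [z _ zmin] := compact_EVT_min S0 cS (continuous_subspaceT cN).
exists (`|f z| + 1) => [|[a b]]; first by rewrite ltr_wpDl.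
have [k k1] := eqmod_itv 0 a P0; have [l l1] := eqmod_itv 0 b P0.
rewrite -(@periodicZ _ _ P (fun a => f (a, b)) (fun a => fl a b) a k).
rewrite -(@periodicZ _ _ P (fun b => f (_, b)) (fr _) b l).
have := zmin (a + P * k%:~R, b + P * l%:~R); rewrite inE => /(_ _).
by rewrite lerN2 => H; rewrite ler_wpDr// H//; split; rewrite /= in_itv/=; lra.
Qed.

Section RuledSurface.
Variables (R : realType) (P : R) (s s1 s2 x x1 x2 : R -> 'rV[R]_3).
Hypotheses (P0 : 0 < P) (cs : closed_C2_curve P s s1 s2) (cx : closed_C2_curve P x x1 x2).
Hypothesis ruled : forall t, det3 (x t) (x1 t) (s1 t) = 0.
Hypothesis W0 : forall t, 0 < det3 (x t) (x1 t) (x2 t).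
Hypothesis chord0 : forall r e, ~ eqmod P e r -> 0 < det3 (x r) (x1 r) (x e).
Let g r e := det3 (x r) (x1 r) (x e).
Let N r e := det3 (x r) (x1 r) (s e - s r).

Let cs0 (i : 'I_3) : continuous (fun t => s t 0 i) := curve_derive_continuous (cc_derive cs).
Let cs2 := cc_cont2 cs.
Let cx0 (i : 'I_3) : continuous (fun t => x t 0 i) := curve_derive_continuous (cc_derive cx).
Let cx1 (i : 'I_3) : continuous (fun t => x1 t 0 i) := curve_derive_continuous (cc_derive2 cx).
Let cx2 := cc_cont2 cx.

Let on_fst (f : R -> R) (y : R * R) : continuous f -> {for y, continuous (fun y => f y.1)}.
Proof. by move=> cf; apply: continuous_comp; [exact: cvg_fst | exact: cf]. Qed.

Let on_snd (f : R -> R) (y : R * R) : continuous f -> {for y, continuous (fun y => f y.2)}.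
Proof. by move=> cf; apply: continuous_comp; [exact: cvg_snd | exact: cf]. Qed.

(* Both [N r] and [g r] vanish to second order at [r]. *)
Lemma ruled_bound : exists2 B, 0 < B &
  forall r e, ~ eqmod P e r -> `|N r e| <= B * g r e.
Proof.
have [||m m0 Hm] := @periodic_min R P (fun t => det3 (x t) (x1 t) (x2 t)) P0 _ _ W0.
- by move=> t; rewrite (cc_period cx) (cc_period1 cx) (cc_period2 cx).
- by move=> t; apply: continuous_det3 => i; [exact: cx0|exact: cx1|exact: cx2].
have [||t|d d0 Hd] := @periodic_tube R P
    (fun p => det3 (x p.1) (x1 p.1) (x2 (p.1 + p.2)) - m / 2) P0.
- by move=> t z /=; rewrite (cc_period cx) (cc_period1 cx) (addrAC t) (cc_period2 cx).
- move=> t; apply: cvgB; last exact: cvg_cst.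
  apply: continuous_det3 => i; [exact: on_fst (@cx0 i)|exact: on_fst (@cx1 i)|].
  apply: (@continuous_comp _ _ _ (fun p : R * R => p.1 + p.2) (fun y => x2 y 0 i)).
    by apply: cvgD; [exact: cvg_fst | exact: cvg_snd].
  exact: cx2.
- by rewrite /= addr0; have := Hm t; lra.
have [|||M1 M10 HM1] := @biperiodic_bounded R P
    (fun p => det3 (x p.1) (x1 p.1) (s2 p.2)) P0.
- move=> p; apply: continuous_det3 => i; [exact: on_fst (@cx0 i)|exact: on_fst (@cx1 i)|].
  exact: on_snd (@cs2 i).
- by move=> a b /=; rewrite (cc_period cx) (cc_period1 cx).
- by move=> a b /=; rewrite (cc_period2 cs).
have [|||M2 M20 HM2] := @biperiodic_bounded R P (fun p => N p.1 p.2) P0.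
- move=> p; rewrite /N; have -> : (fun p : R * R => N p.1 p.2) = (fun p =>
    det3 (x p.1) (x1 p.1) (s p.2) - det3 (x p.1) (x1 p.1) (s p.1)).
    by apply/funext => q; rewrite /N /det3 !mxE; ring.
  by apply: cvgB; apply: continuous_det3 => i;
    [exact: on_fst (@cx0 i)|exact: on_fst (@cx1 i)|exact: on_snd (@cs0 i)
    |exact: on_fst (@cx0 i)|exact: on_fst (@cx1 i)|exact: on_fst (@cs0 i)].
- by move=> a b /=; rewrite /N (cc_period cx) (cc_period1 cx) (cc_period cs).
- by move=> a b /=; rewrite /N (cc_period cs).
have cg : continuous (fun p : R * R => g p.1 p.2) by exact: (chord_cont cx).
have [m' m'0 Hm'] : exists2 m', 0 < m' &
    forall r e, 0 <= r <= P -> d <= e - r <= P - d -> m' <= g r e.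
  pose C := [set p : R * R | 0 <= p.1 <= P /\ d <= p.2 - p.1 <= P - d].
  have difc : continuous (fun p : R * R => p.2 - p.1).
    by move=> p; apply: cvgB; [exact: cvg_snd | exact: cvg_fst].
  have fstc : continuous (fun p : R * R => p.1) by move=> p; exact: cvg_fst.
  have cstc (k : R) : continuous (fun _ : R * R => k) by move=> p; exact: cvg_cst.
  have clC : closed C.
    have -> : C = [set p | 0 <= p.1] `&` [set p | p.1 <= P]
        `&` [set p | d <= p.2 - p.1] `&` [set p | p.2 - p.1 <= P - d].
      apply/seteqP; split=> [p [/andP[? ?] /andP[? ?]]|p [[[h1 h2] h3] h4]].
        by do ![split].
      by split; apply/andP.
    by do ![apply: closedI]; apply: closed_le_fct.
  have bC p : C p -> `|p.1| <= P + P /\ `|p.2| <= P + P.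
    by case: p => a b; rewrite /C /= => -[? ?]; rewrite !ler_norml; lra.
  have [Ce|/set0P C0] := eqVneq C set0.
    exists 1 => // r e h1 h2; exfalso; suff : C (r, e) by rewrite Ce.
    by split.
  have [[a b] Cab min] := closed_argmin clC C0 cg bC.
  exists (g a b); last by move=> r e h1 h2; apply: (min (r, e)).
  move: Cab; rewrite /C /= => -[h1 h2].
  by apply: chord0; apply: eqmod_dist_lt; rewrite gtr0_norm; lra.
(* Near the diagonal the second derivative of [g r] exceeds [m / 2] and that of [N r] is at most
   [M1], so [2 * M1 / m] compares them and the 1 makes the comparison strict. Away from the diagonal
   [M2 / m'] suffices. *)
pose B := 2 * M1 / m + 1 + M2 / m'.
have B0 : 0 < B by rewrite /B !addr_gt0// divr_gt0// mulr_gt0.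
have near r e : 0 < `|e - r| < d -> `|N r e| <= B * g r e.
  move=> er; have key (k : R) : `|k| = 1 -> 0 < B * g r e + k * N r e.
    move=> k1; apply: (@gt0_second_derive R (fun e => B * g r e + k * N r e)
      (fun e => B * det3 (x r) (x1 r) (x1 e) + k * det3 (x r) (x1 r) (s1 e))
      (fun e => B * det3 (x r) (x1 r) (x2 e) + k * det3 (x r) (x1 r) (s2 e)) r d
      _ _ _ _ _ e er).
    - move=> t.
      have h1 := @is_derive_det3 R _ _ x _ _ x1 t (curve_derive_cst t (x r))
        (curve_derive_cst t (x1 r)) (cc_derive cx t).
      have h2 := @is_derive_det3 R _ _ s _ _ s1 t (curve_derive_cst t (x r))
        (curve_derive_cst t (x1 r)) (cc_derive cs t).
      rewrite /= !det3_0l !det3_0m !add0r in h1 h2.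
      have -> : (fun e => B * g r e + k * N r e) = (fun e => B * det3 (x r) (x1 r) (x e)
          + k * det3 (x r) (x1 r) (s e) + - k * det3 (x r) (x1 r) (s r)).
        by apply/funext => z; rewrite /g /N /det3 !mxE; ring.
      by apply: is_derive_eq; rewrite /GRing.scale/=; ring.
    - move=> t.
      have h1 := @is_derive_det3 R _ _ x1 _ _ x2 t (curve_derive_cst t (x r))
        (curve_derive_cst t (x1 r)) (cc_derive2 cx t).
      have h2 := @is_derive_det3 R _ _ s1 _ _ s2 t (curve_derive_cst t (x r))
        (curve_derive_cst t (x1 r)) (cc_derive2 cs t).
      rewrite /= !det3_0l !det3_0m !add0r in h1 h2.
      by apply: is_derive_eq; rewrite /GRing.scale/=; ring.
    - by rewrite /g /N subrr det3_aba det3_0r !mulr0 addr0.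
    - by rewrite det3_abb ruled !mulr0 addr0.
    - move=> z zr; have := Hd r (z - r) zr; rewrite /= addrCA subrr addr0 => K.
      have := HM1 (r, z); rewrite /= => M.
      have : `|k * det3 (x r) (x1 r) (s2 z)| <= M1 by rewrite normrM k1 mul1r.
      rewrite ler_norml => /andP[+ _].
      have : M1 + m / 2 <= B * (m / 2).
        have -> : B * (m / 2) = M1 + m / 2 + M2 / m' * (m / 2).
          by rewrite /B; field; rewrite gt_eqF// gt_eqF.
        by rewrite lerDl mulr_ge0// divr_ge0// ltW.
      have : B * (m / 2) < B * det3 (x r) (x1 r) (x2 z) by rewrite ltr_pM2l//; lra.
      lra.
  have := key 1 (normr1 _); have := key (-1); rewrite normrN normr1 => /(_ erefl).
  by rewrite ler_norml; lra.
exists B => // r e er.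
have [k k1] := eqmod_itv 0 r P0; have [l l1] := eqmod_itv (r + P * k%:~R) e P0.
set r' := r + _ in k1 l1; set e' := e + _ in l1.
have gE z : g r z = g r' z.
  by rewrite /g /r' (periodicZ (cc_period cx) r) (periodicZ (cc_period1 cx) r).
have -> : g r e = g r' e' by rewrite gE /g /e' (periodicZ (cc_period cx) e).
have -> : N r e = N r' e'.
  rewrite /N /r' /e' (periodicZ (cc_period cx) r) (periodicZ (cc_period1 cx) r).
  by rewrite (periodicZ (cc_period cs) r) (periodicZ (cc_period cs) e).
have er' : r' != e'.
  apply/eqP => E; apply: er; exists (k - l); rewrite intrB mulrBr.
  by rewrite addrA -/r' E /e' addrK.
have re' : r' < e' by rewrite lt_neqAle er'; lra.
have [l2|l2] := ltP (e' - r') d; first by apply: near; rewrite gtr0_norm; lra.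
have [l3|l3] := ltP (P - d) (e' - r').
  have -> : g r' e' = g (r' + P) e' by rewrite /g (cc_period cx) (cc_period1 cx).
  have -> : N r' e' = N (r' + P) e'.
    by rewrite /N (cc_period cx) (cc_period1 cx) (cc_period cs).
  by apply: near; rewrite ltr0_norm; lra.
have gm : m' <= g r' e' by apply: Hm'; lra.
apply: le_trans (HM2 (r', e')) _.
have -> : M2 = M2 / m' * m' by rewrite divfK// gt_eqF.
apply: (le_trans (ler_wpM2l _ gm)); first by rewrite divr_ge0// ltW.
apply: ler_wpM2r; first by apply: le_trans gm; rewrite ltW.
by rewrite /B lerDr addr_ge0// divr_ge0 ?mulr_ge0// ltW.
Qed.

(** Testing against the plane at [t1] annihilates [v1 *: x t1], so only [v2] has to be large; its
    absolute value serves both ends. *)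
Lemma ruled_injective : exists2 B, 0 < B & forall t1 t2 v1 v2, B <= `|v2| ->
  s t1 + v1 *: x t1 = s t2 + v2 *: x t2 -> eqmod P t1 t2.
Proof.
have [B B0 HB] := ruled_bound; exists (B + 1) => [|t1 t2 v1 v2 Bv E]; first by rewrite addr_gt0.
apply: contrapT => t12; have {}t12 : ~ eqmod P t2 t1 by move=> /eqmod_sym.
have NE : N t1 t2 = - (v2 * g t1 t2).
  have E' : s t2 - s t1 = v1 *: x t1 + (- v2) *: x t2.
    by rewrite scaleNr; apply/eqP; rewrite subr_eq addrAC -subr_eq opprK addrC -E addrC.
  by rewrite /N E' det3D !det3Z det3_aba mulr0 add0r mulNr.
have g0 := chord0 t12; have := HB _ _ t12.
rewrite NE normrN normrM (gtr0_norm g0) ler_pM2r//.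
lra.
Qed.

End RuledSurface.

(** * Duality *)

Definition simple_closed (R : realType) (P : R) (c : R -> 'rV[R]_3) : Prop :=
  forall t1 t2, c t1 = c t2 -> eqmod P t1 t2.

Lemma closed_C2_curve_opp (R : realType) (P : R) (c c1 c2 : R -> 'rV[R]_3) :
  closed_C2_curve P c c1 c2 ->
  closed_C2_curve P (fun t => - c t) (fun t => - c1 t) (fun t => - c2 t).
Proof.
have opp f f1 : curve_derive f f1 -> curve_derive (fun t => - f t) (fun t => - f1 t).
  move=> h t i; have := h t i => h'; under eq_fun do rewrite mxE.
  by apply: is_derive_eq; rewrite mxE.
case=> h1 h2 h3 h4; split; [exact: opp | exact: opp | |].
- move=> i; have -> : (fun t => (- c2 t) 0 i) = (fun t => - c2 t 0 i).
    by apply/funext => t; rewrite mxE.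
  by move=> t; apply: cvgN; exact: h3.
- by move=> t; rewrite h4.
Qed.

Lemma det3N (R : realType) (u v w : 'rV[R]_3) :
  det3 (- u) (- v) (- w) = - det3 u v w.
Proof. by rewrite /det3 !mxE; ring. Qed.

Lemma dotNN (R : realType) (u v : 'rV[R]_3) : dot (- u) (- v) = dot u v.
Proof. by rewrite !dot3E !mxE; ring. Qed.

Section Signs.
Variables (R : realType) (P : R).
Hypothesis P0 : 0 < P.

(** A continuous function without zeros has constant sign. Passing to the antipodal curve settles
    the negative case, since simplicity and the unit length are unaffected. *)
Lemma wronskian_sign (x x1 x2 : R -> 'rV[R]_3) :
  closed_C2_curve P x x1 x2 -> (forall t, det3 (x t) (x1 t) (x2 t) != 0) ->
  (forall t, 0 < det3 (x t) (x1 t) (x2 t)) \/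
  (forall t, 0 < det3 (- x t) (- x1 t) (- x2 t)).
Proof.
move=> cx W0; pose W t := det3 (x t) (x1 t) (x2 t).
have cW : continuous W.
  move=> t; apply: continuous_det3 => i.
  - exact: (curve_derive_continuous (cc_derive cx)).
  - exact: (curve_derive_continuous (cc_derive2 cx)).
  - exact: (cc_cont2 cx).
have cNW : continuous (fun t => - W t) by move=> t; apply: cvgN; exact: cW.
have sign (f : R -> R) : continuous f -> (forall t, f t != 0) -> 0 < f 0 -> forall t, 0 < f t.
  move=> cf f0 fp t; have := ler_norm t; have := ler_norm (- t); rewrite normrN => h1 h2.
  have n0 := normr_ge0 t.
  apply: (@pos_of_nonzero R f (- `|t| - 1) (`|t| + 1)) => //; last lra.
  by exists 0 => //; lra.
have [W00|W00] := ltP 0 (W 0); first by left; exact: sign.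
right=> t; rewrite det3N; apply: (sign (fun t => - W t)) => //.
- by move=> u; rewrite oppr_eq0; exact: W0.
- by rewrite oppr_gt0 lt_neqAle W0.
Qed.

Lemma unit_chord_gt0 (y y1 y2 : R -> 'rV[R]_3) : closed_C2_curve P y y1 y2 ->
  (forall t, 0 < det3 (y t) (y1 t) (y2 t)) ->
  (forall t, dot (y t) (y t) = 1) -> simple_closed P y ->
  forall r e, ~ eqmod P e r -> 0 < det3 (y r) (y1 r) (y e).
Proof.
move=> cy Wy uy sy r e er; apply: (chord_gt0 P0 cy Wy) => // a b z z0 yb.
apply: sy; rewrite yb; suff -> : z = 1 by rewrite scale1r.
have := uy b; rewrite yb.
have -> : dot (z *: y a) (z *: y a) = z ^+ 2 * dot (y a) (y a).
  by rewrite !dot3E !mxE; ring.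
rewrite uy mulr1 => /eqP; rewrite sqrf_eq1 => /orP[/eqP//|/eqP zN].
by move: z0; rewrite zN; lra.
Qed.

Lemma chord_neq0 (x x1 x2 : R -> 'rV[R]_3) :
  closed_C2_curve P x x1 x2 -> (forall t, det3 (x t) (x1 t) (x2 t) != 0) ->
  (forall t, dot (x t) (x t) = 1) -> simple_closed P x ->
  forall r e, ~ eqmod P e r -> det3 (x r) (x1 r) (x e) != 0.
Proof.
move=> cx W0 ux sx r e er.
have [Wp|Wn] := wronskian_sign cx W0.
  by rewrite gt_eqF// (unit_chord_gt0 cx).
have := unit_chord_gt0 (closed_C2_curve_opp cx) Wn.
rewrite -oppr_eq0 -det3N => H; rewrite gt_eqF// H//.
- by move=> t; rewrite dotNN.
- by move=> a b /oppr_inj; exact: sx.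
Qed.

Lemma dual_simple (u u1 n : R -> 'rV[R]_3) :
  (forall r e, ~ eqmod P e r -> det3 (u r) (u1 r) (u e) != 0) ->
  (forall t, dot (n t) (n t) = 1) -> (forall t, dot (n t) (u t) = 0) ->
  (forall t, dot (n t) (u1 t) = 0) -> simple_closed P n.
Proof.
move=> ch nn nu nu1 r e nre; apply: contrapT => re.
have /eqP := ch r e (fun h => re (eqmod_sym h)); apply.
rewrite -[LHS]mulr1 -(nn r).
(* The linear relation between four vectors of 3-space, paired with [n r]; the last pairing left,
   [dot (n r) (u e)], vanishes since [n r = n e]. *)
have -> : det3 (u r) (u1 r) (u e) * dot (n r) (n r) =
    det3 (u r) (u1 r) (n r) * dot (n r) (u e)
    - det3 (u r) (u e) (n r) * dot (n r) (u1 r)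
    + det3 (u1 r) (u e) (n r) * dot (n r) (u r).
  by rewrite !dot3E /det3; ring.
by rewrite nu nu1 nre nu !mulr0 subr0 addr0.
Qed.

Section Ruled.
Variables (s s1 s2 x x1 x2 : R -> 'rV[R]_3).
Hypotheses (cs : closed_C2_curve P s s1 s2) (cx : closed_C2_curve P x x1 x2).
Hypothesis ruled : forall t, det3 (x t) (x1 t) (s1 t) = 0.
Hypothesis W0 : forall t, det3 (x t) (x1 t) (x2 t) != 0.
Hypothesis ux : forall t, dot (x t) (x t) = 1.

Lemma simple_ruled_injective : simple_closed P x ->
  exists2 B, 0 < B & forall t1 t2 v1 v2, B <= `|v2| ->
  s t1 + v1 *: x t1 = s t2 + v2 *: x t2 -> eqmod P t1 t2.
Proof.
move=> sx; have [Wp|Wn] := wronskian_sign cx W0.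
  exact: (ruled_injective P0 cs cx ruled Wp (unit_chord_gt0 cx Wp ux sx)).
have cNx := closed_C2_curve_opp cx; have cNs := closed_C2_curve_opp cs.
have [|||B B0 HB] := ruled_injective P0 cNs cNx _ Wn (unit_chord_gt0 cNx Wn _ _).
- by move=> t; rewrite det3N ruled oppr0.
- by move=> t; rewrite dotNN.
- by move=> a b /oppr_inj; exact: sx.
exists B => // t1 t2 v1 v2 Bv E; apply: (HB t1 t2 v1 v2 Bv).
by rewrite !scalerN -!opprD E.
Qed.

Lemma ruled_embedding_simple (v0 : R) :
  (forall t1 t2 v1 v2, v0 <= v1 -> v0 <= v2 ->
    s t1 + v1 *: x t1 = s t2 + v2 *: x t2 -> eqmod P t1 t2) -> simple_closed P x.
Proof.
move=> inj; have [Wp|Wn] := wronskian_sign cx W0.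
  exact: (simple_of_ruled_embedding P0 cs cx ux Wp inj).
move=> t1 t2 x12.
apply: (simple_of_ruled_embedding P0 (closed_C2_curve_opp cs)
  (closed_C2_curve_opp cx) _ Wn (v0 := v0)).
- by move=> t; rewrite dotNN.
- move=> a b v1 v2 h1 h2; rewrite !scalerN -!opprD => /oppr_inj; exact: inj.
- by rewrite x12.
Qed.

End Ruled.
End Signs.

Section Duality.
Variables (R : realType) (P : R) (x x1 x2 n n1 n2 : R -> 'rV[R]_3).
Hypotheses (P0 : 0 < P).
Hypotheses (cx : closed_C2_curve P x x1 x2) (cn : closed_C2_curve P n n1 n2).
Hypothesis W0 : forall t, det3 (x t) (x1 t) (x2 t) != 0.
Hypotheses (ux : forall t, dot (x t) (x t) = 1) (un : forall t, dot (n t) (n t) = 1).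
Hypotheses (nx : forall t, dot (n t) (x t) = 0) (nx1 : forall t, dot (n t) (x1 t) = 0).

Let dconst (u v u1 v1 : R -> 'rV[R]_3) (k : R) t : curve_derive u u1 -> curve_derive v v1 ->
  (forall t, dot (u t) (v t) = k) -> dot (u1 t) (v t) + dot (u t) (v1 t) = 0.
Proof.
move=> hu hv uv; have := is_derive_dot3 (hu t) (hv t).
under eq_fun do rewrite uv; move=> h.
by apply: (is_derive_uniq h); exact: is_derive_cst.
Qed.

(** With this, the relation between a curve and its dual is symmetric, so each direction of
    [dual_simpleP] is the same argument. *)
Lemma dual_tangent t : dot (n1 t) (x t) = 0.
Proof.
by have := dconst t (cc_derive cn) (cc_derive cx) nx; rewrite nx1 addr0.
Qed.

Lemma dual_n1x1 t : dot (n1 t) (x1 t) != 0.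
Proof.
have := dconst t (cc_derive cn) (cc_derive2 cx) nx1 => /eqP; rewrite addr_eq0 => /eqP ->.
rewrite oppr_eq0; apply/eqP => nx2; have /eqP := W0 t; apply.
rewrite -[LHS]mulr1 -(un t).
have -> : det3 (x t) (x1 t) (x2 t) * dot (n t) (n t) =
    det3 (x t) (x1 t) (n t) * dot (n t) (x2 t)
    - det3 (x t) (x2 t) (n t) * dot (n t) (x1 t)
    + det3 (x1 t) (x2 t) (n t) * dot (n t) (x t).
  by rewrite !dot3E /det3; ring.
by rewrite nx2 nx nx1 !mulr0 subr0 addr0.
Qed.

Lemma dual_regular t : n1 t != 0.
Proof.
apply/eqP => n10; have /eqP := dual_n1x1 t; apply.
by rewrite n10 dot3E !mxE; ring.
Qed.

Lemma dual_wronskian t : det3 (n t) (n1 t) (n2 t) != 0.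
Proof.
have n1n : dot (n1 t) (n t) = 0.
  have := dconst t (cc_derive cn) (cc_derive cn) un.
  rewrite [X in _ + X](_ : _ = dot (n1 t) (n t)); last by rewrite !dot3E; ring.
  lra.
have xn2 : dot (x t) (n2 t) != 0.
  have := dconst t (cc_derive2 cn) (cc_derive cx) dual_tangent => /eqP.
  rewrite addr_eq0 => /eqP E; rewrite (_ : dot _ _ = dot (n2 t) (x t)).
    by rewrite E oppr_eq0 dual_n1x1.
  by rewrite !dot3E; ring.
have n1n1 : dot (n1 t) (n1 t) != 0.
  by apply: contra_neq (dual_regular t); exact: dot3_eq0.
(* The square is the Gram determinant of [n t], [n1 t], [x t], which orthogonality reduces to
   [dot (n1 t) (n1 t)]. *)
have dn : det3 (n t) (n1 t) (x t) != 0.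
  rewrite -sqrf_eq0.
  have -> : det3 (n t) (n1 t) (x t) ^+ 2 =
    dot (n t) (n t) * (dot (n1 t) (n1 t) * dot (x t) (x t) - dot (n1 t) (x t) ^+ 2)
    - dot (n1 t) (n t) * (dot (n1 t) (n t) * dot (x t) (x t) - dot (n1 t) (x t) * dot (n t) (x t))
    + dot (n t) (x t) * (dot (n1 t) (n t) * dot (n1 t) (x t) - dot (n1 t) (n1 t) * dot (n t) (x t)).
    by rewrite !dot3E /det3; ring.
  by rewrite un ux n1n dual_tangent nx !mul0r subr0 addr0 mul1r mulr1 expr2 mulr0 subr0.
rewrite -[X in X != _]mulr1 -(ux t).
have -> : det3 (n t) (n1 t) (n2 t) * dot (x t) (x t) =
    det3 (n t) (n1 t) (x t) * dot (x t) (n2 t)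
    - det3 (n t) (n2 t) (x t) * dot (n1 t) (x t)
    + det3 (n1 t) (n2 t) (x t) * dot (n t) (x t).
  by rewrite !dot3E /det3; ring.
by rewrite dual_tangent nx !mulr0 subr0 addr0 mulf_neq0.
Qed.

Lemma dual_simpleP : simple_closed P x <-> simple_closed P n.
Proof.
have dotC (u v : 'rV[R]_3) : dot u v = dot v u by rewrite !dot3E; ring.
split=> [sx|sn].
- by apply: (dual_simple (chord_neq0 P0 cx W0 ux sx) un).
- apply: (dual_simple (chord_neq0 P0 cn dual_wronskian un sn) ux) => t.
    by rewrite dotC.
  by rewrite dotC dual_tangent.
Qed.

End Duality.

(** * The curve sigma_hat *)

Lemma Cn_derivable1 (R : realType) (W : normedModType R) (n : nat) (f : R -> W) :
  Cn n.+1 [set: R] f -> (forall t : R, derivable f t 1) /\ Cn n [set: R] (derive1 f).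
Proof.
move=> [_ /(_ 1)[df Df]]; split; first by move=> t; exact: df.
suff -> : (derive1 f) = 'D_1 f by [].
by apply/funext => t; rewrite derive1E.
Qed.

Lemma derivable_curve_derive (R : realType) (c : R -> 'rV[R]_3) :
  (forall t : R, derivable c t 1) -> curve_derive c (derive1 c).
Proof.
move=> dc t i; apply: DeriveDef; first exact: ((derivable_mxP _ _ _).1 (dc t)).
by rewrite derive1E derive_mx// mxE.
Qed.

Lemma smooth_closed_C2_curve (R : realType) (P : R) (c : R -> 'rV[R]_3) :
  smooth_on [set: R] c -> (forall t, c (t + P) = c t) ->
  closed_C2_curve P c (derive1 c) (derive1 (derive1 c)).
Proof.
move=> sc cP; have [d0 /Cn_derivable1[d1 /Cn_derivable1[d2 _]]] := Cn_derivable1 (sc 3).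
split=> //; [exact: derivable_curve_derive | exact: derivable_curve_derive |].
by move=> i; exact: (curve_derive_continuous (derivable_curve_derive d2)).
Qed.

Lemma smooth_is_derive (R : realType) (a : R -> R) : smooth_on [set: R] a ->
  (forall t, is_derive (t : R) 1 a (derive1 a t)) /\ continuous (derive1 a).
Proof.
move=> sa; have [d0 /Cn_derivable1[d1 _]] := Cn_derivable1 (sa 2).
have h (f : R -> R) : (forall t : R, derivable f t 1) -> forall t, is_derive (t : R) 1 f (derive1 f t).
  by move=> df t; apply: DeriveDef; [exact: df | rewrite derive1E].
split; first exact: h.
exact: (is_derive_continuous (h _ d1)).
Qed.

Lemma continuous_itv_integrable (R : realType) (h : R -> R) (a b : R) :
  continuous h -> lebesgue_measure.-integrable `[a, b] (EFin \o h).
Proof.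
move=> ch; apply: continuous_compact_integrable; first exact: segment_compact.
exact: continuous_subspaceT.
Qed.

(** A base point to the left of both 0 and [t] removes the case split on the sign of [t], so that
    the fundamental theorem of calculus also applies at 0. *)
Lemma oriented_integralE (R : realType) (h : R -> R) (m t : R) :
  continuous h -> m < 0 -> m < t ->
  oriented_integral h t = (\int[lebesgue_measure]_(s in `[m, t]) h s)
    - (\int[lebesgue_measure]_(s in `[m, 0]) h s).
Proof.
move=> ch m0 mt.
have ih a b := continuous_itv_integrable a b ch.
have split a b : m <= a -> a <= b ->
    \int[lebesgue_measure]_(s in `[m, b]) h s =
    \int[lebesgue_measure]_(s in `[m, a]) h s + \int[lebesgue_measure]_(s in `[a, b]) h s.
  move=> ma ab; have := @Rintegral_itvB R h (BLeft m) (BRight b) a (ih m b).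
  rewrite !bnd_simp => /(_ ma ab) => E.
  rewrite -(Rintegral_itv_obnd_cbnd (r := a)) -?E; first by rewrite addrC subrK.
  by apply: integrableS (ih a b) => //; exact: subset_itv_oc_cc.
rewrite /oriented_integral; have [t0|t0|<-] := ltgtP 0 t.
- rewrite [X in _ - X](_ : _ = 0) ?subr0; last by rewrite set_itv_ge ?Rintegral_set0// bnd_simp -ltNge.
  by rewrite (split 0 t) ?(ltW m0) ?(ltW t0)// addrAC subrr add0r.
- rewrite [X in X - _](_ : _ = 0); last by rewrite set_itv_ge ?Rintegral_set0// bnd_simp -ltNge.
  by rewrite (split t 0) ?(ltW mt) ?(ltW t0)// opprD addrA subrr.
- by rewrite !subrr.
Qed.

Lemma is_derive_oriented_integral (R : realType) (h : R -> R) (t : R) :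
  continuous h -> is_derive t 1 (oriented_integral h) (h t).
Proof.
move=> ch; pose m := - (`|t| + 1).
have m0 : m < 0 by rewrite oppr_lt0 ltr_wpDl.
have mt : m < t by have := ler_norm (- t); rewrite normrN /m; lra.
have ih a b := continuous_itv_integrable a b ch.
apply: (@near_eq_is_derive _ _ _ (fun u => (\int[lebesgue_measure]_(s in `[m, u]) h s)
    - (\int[lebesgue_measure]_(s in `[m, 0]) h s))).
  near=> u; apply/esym/oriented_integralE => //.
  by near: u; exact: lt_nbhsr.
have [|dF FE] := @continuous_FTC1_closed R h m t (t + 1) _ (ih m (t + 1)) mt (ch t).
  by rewrite ltrDl.
have dF' : is_derive t 1 (fun u => \int[lebesgue_measure]_(s in `[m, u]) h s) (h t).
  by apply: DeriveDef; [exact: dF | rewrite -FE derive1E].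
by apply: is_derive_eq; rewrite oppr0 addr0.
Unshelve. all: by end_near. Qed.

Lemma oriented_integral0 (R : realType) (h : R -> R) : oriented_integral h 0 = 0.
Proof. by rewrite /oriented_integral subrr. Qed.

Lemma sigma_hat_closed_C2_curve (R : realType) (P : R) (a : R -> R) (x : R -> 'rV[R]_3) :
  smooth_on [set: R] a -> (forall t, a (t + P) = a t) ->
  smooth_on [set: R] x -> (forall t, x (t + P) = x t) -> sigma_hat a x P = 0 ->
  closed_C2_curve P (sigma_hat a x) (fun t => a t *: x t)
    (fun t => derive1 a t *: x t + a t *: derive1 x t).
Proof.
move=> sa aP sx xP sP; have [da ca1] := smooth_is_derive sa.
have cx := smooth_closed_C2_curve sx xP.
have ca := is_derive_continuous da.
have cx0 (i : 'I_3) : continuous (fun t => x t 0 i) := curve_derive_continuous (cc_derive cx).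
have cx1 (i : 'I_3) : continuous (fun t => derive1 x t 0 i) := curve_derive_continuous (cc_derive2 cx).
have ds : curve_derive (sigma_hat a x) (fun t => a t *: x t).
  move=> t i; rewrite mxE.
  have -> : (fun u => sigma_hat a x u 0 i) = oriented_integral (fun s => a s * x s 0 i).
    by apply/funext => u; rewrite mxE.
  apply: (@is_derive_oriented_integral R (fun s => a s * x s 0 i)) => u.
  by apply: cvgM; [exact: ca | exact: cx0].
split=> //.
- move=> t i; have h1 := da t; have h2 := cc_derive cx t i.
  have -> : (fun u => (a u *: x u) 0 i) = (fun u => a u * x u 0 i).
    by apply/funext => u; rewrite mxE.
  by apply: is_derive_eq; rewrite /GRing.scale !mxE/=; ring.
- move=> i; have -> : (fun u => (derive1 a u *: x u + a u *: derive1 x u) 0 i) =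
      (fun u => derive1 a u * x u 0 i + a u * derive1 x u 0 i).
    by apply/funext => u; rewrite !mxE.
  by move=> t; apply: cvgD; apply: cvgM; [exact: ca1|exact: cx0|exact: ca|exact: cx1].
(* The increment over one period is constant, and at 0 it vanishes by the closing condition [sP]. *)
- move=> t; apply/rowP => i; pose f u := sigma_hat a x (P + u) 0 i - sigma_hat a x u 0 i.
  have df (u : R) : is_derive u 1 f 0.
    have h1 := @is_derive_shiftl R (fun u => sigma_hat a x u 0 i) P u _ (ds (P + u) i).
    have h2 := ds u i.
    by apply: is_derive_eq; rewrite (addrC P) aP xP subrr.
  have f0 u : f u = 0.
    have f00 : f 0 = 0.
      by rewrite /f addr0 sP !mxE oriented_integral0 subr0.
    have [u0|u0|<-//] := ltgtP 0 u.
    + by have [c _] := mvt df u0; rewrite f00 subr0 mul0r.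
    + by have [c _] := mvt df u0; rewrite f00 sub0r mul0r => /eqP; rewrite oppr_eq0 => /eqP.
  by have /eqP := f0 t; rewrite subr_eq0 (addrC P) => /eqP.
Qed.

(** * Fronts parametrized by the cylinder *)

Lemma derive_line (R : realType) (V W : normedModType R) (g : V -> W) (x u : V) :
  'D_u g x = 'D_1 (fun h : R => g (h *: u + x)) 0.
Proof.
rewrite /derive; set g1 := fun h => h^-1 *: _; set g2 := fun h => h^-1 *: _.
suff -> : g1 = g2 by [].
by apply/funext => h; rewrite /g1 /g2 /= addr0 scale0r add0r [_%:A]mulr1.
Qed.

Lemma derive_coord_line (R : realType) (V : normedModType R) (g : V -> 'rV[R]_3)
    (x u : V) (G : R -> 'rV[R]_3) (d : 'rV[R]_3) :
  (\forall h \near (0 : R), g (h *: u + x) = G h) ->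
  (forall i, is_derive (0 : R) 1 (fun h => G h 0 i) (d 0 i)) -> 'D_u g x = d.
Proof.
move=> gG dG; have dgi i : is_derive (0 : R) 1 (fun h => g (h *: u + x) 0 i) (d 0 i).
  apply: (@near_eq_is_derive _ _ _ (fun h => G h 0 i)).
  by near=> h; rewrite (near gG h).
rewrite derive_line derive_mx.
  by apply/rowP => i; rewrite mxE; have [_ ->] := dgi i.
by apply/derivable_mxP => i j; rewrite ord1; have [] := dgi j.
Unshelve. all: by end_near. Qed.

Lemma is_derive0_cvg (R : realType) (g : R -> R) (d : R) :
  h^-1 *: (g h - g 0) @[h --> 0^'] --> d -> is_derive (0 : R) 1 g d.
Proof.
move=> cv; have cv' : (fun h => h^-1 *: ((g \o shift 0) h%:A - g 0)) @ 0^' --> d.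
  suff -> : (fun h => h^-1 *: ((g \o shift 0) h%:A - g 0)) =
            (fun h => h^-1 *: (g h - g 0)) by [].
  by apply/funext => h /=; rewrite addr0 [_%:A]mulr1.
by apply: DeriveDef; [apply/cvg_ex; exists d | exact: (cvg_lim _ cv')].
Qed.

Lemma is_derive_line_pair (R : realType) (V : normedModType R) (L : V -> R * R) (x u : V) :
  derivable L x u ->
  is_derive (0 : R) 1 (fun h => (L (h *: u + x)).1) ('D_u L x).1 /\
  is_derive (0 : R) 1 (fun h => (L (h *: u + x)).2) ('D_u L x).2.
Proof.
move=> dL; have cv : h^-1 *: (L (h *: u + x) - L x) @[h --> 0^'] --> 'D_u L x by exact: dL.
split; apply: is_derive0_cvg; rewrite scale0r add0r.
- by apply: (cvg_comp (fun h => h^-1 *: (L (h *: u + x) - L x)) fst cv); exact: cvg_fst.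
- by apply: (cvg_comp (fun h => h^-1 *: (L (h *: u + x) - L x)) snd cv); exact: cvg_snd.
Qed.

Lemma curve_derive_continuous_mx (R : realType) (c c' : R -> 'rV[R]_3) :
  curve_derive c c' -> continuous c.
Proof.
move=> h t; apply: differentiable_continuous; apply/derivable1_diffP/derivable_mxP => i j.
by rewrite ord1; have [] := h t j.
Qed.

Section CylinderFront.
Variables (R : realType) (M : surface R) (f nu : M -> 'rV[R]_3) (phi : R * R -> M).
Variables (b : 'rV[R]_3) (s s1 x x1 x2 n n1 : R -> 'rV[R]_3).
Hypothesis fr : front f nu.
Hypothesis cyl : cylinder_diffeo phi.
Hypotheses (ds : curve_derive s s1) (dx : curve_derive x x1) (dn : curve_derive n n1).
Hypothesis W0 : forall t, det3 (x t) (x1 t) (x2 t) != 0.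
Hypothesis ruled : forall t, det3 (x t) (s1 t) (x2 t) = 0.
Hypothesis ux : forall t, dot (x t) (x t) = 1.
Hypotheses (sP : forall t, s (t + 2 * pi) = s t) (xP : forall t, x (t + 2 * pi) = x t).
Hypothesis fE : forall t v, f (phi (t, v)) = b + s t + v *: x t.
Hypothesis nuE : forall t v, nu (phi (t, v)) = n t.

(** Off [v = 0], a vector killed by the differential of [f] has no component along [t]. As [nu]
    depends on [t] alone, its differential kills the vector too, and the front condition makes the
    vector zero. The coordinates come from a local lift of the inverse of [phi]. *)
Lemma cylinder_immersion t v : v != 0 -> immersion_at f (phi (t, v)).
Proof.
move=> v0 c atc; set p := phi (t, v) => cp u dfu.
have [_ _ _ _ /(_ c atc p cp u dfu)] := fr; apply.
have [_ phiinj _ /(_ p)[U [l [oU Up sl lK]]]] := cyl.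
pose L := l \o chart_inv c; pose x0 := c p.
have x0D : (c @` (chart_dom c `&` U)) x0 by exists p.
have dL : derivable L x0 u.
  by have [_ /(_ u)[/(_ x0 x0D)]] := sl c atc 1%N.
have [dT dV] := is_derive_line_pair dL.
set T := (fun h => _) in dT; set V := (fun h => _) in dV.
have Ux0 : \forall h \near (0 : R), U (chart_inv c (h *: u + x0)).
  have cline : (fun h : R => h *: u + x0) @ (0 : R) --> x0.
    rewrite -[X in _ --> X]add0r -(scale0r u); apply: cvgD; last exact: cvg_cst.
    by apply: cvgZr_tmp; exact: cvg_id.
  apply: (cline (fun y => U (chart_inv c y))).
  apply: (chart_inv_cont cp); rewrite chart_mapK//.
  exact: open_nbhs_nbhs.
have LE h : U (chart_inv c (h *: u + x0)) -> chart_inv c (h *: u + x0) = phi (T h, V h).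
  by move=> Uh; rewrite -(lK _ Uh) /T /V /L /=; case: (l _).
have fL : \forall h \near (0 : R), (f \o chart_inv c) (h *: u + x0) = b + s (T h) + V h *: x (T h).
  by near=> h; rewrite /= LE ?fE//; near: h.
have nL : \forall h \near (0 : R), (nu \o chart_inv c) (h *: u + x0) = n (T h).
  by near=> h; rewrite /= LE ?nuE//; near: h.
set T' := ('D_u L x0).1 in dT; set V' := ('D_u L x0).2 in dV.
have chain (c' c1' : R -> 'rV[R]_3) i : curve_derive c' c1' ->
    is_derive (0 : R) 1 (fun h => c' (T h) 0 i) (c1' (T 0) 0 i * T').
  by move=> dc; exact: (is_derive1_comp (dc (T 0) i) dT).
have E : T' *: s1 (T 0) + (V' *: x (T 0) + (V 0 * T') *: x1 (T 0)) = 0.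
  rewrite -dfu /dchart -/x0; apply/esym/(derive_coord_line fL) => i.
  have h1 := chain _ _ i ds; have h2 := chain _ _ i dx.
  have -> : (fun h => (b + s (T h) + V h *: x (T h)) 0 i) =
      (fun h => b 0 i + s (T h) 0 i + V h * x (T h) 0 i).
    by apply/funext => h; rewrite !mxE.
  by apply: is_derive_eq; rewrite /GRing.scale !mxE/=; ring.
have VE : V 0 = v.
  have := lK p Up; rewrite /V /L /= scale0r add0r chart_mapK// /p.
  by case: (l _) => a w /phiinj[_].
(* The determinant with [x] and [x2] removes the term in [V'] and, by [ruled], the one in [s1]; what
   remains is [V 0 * T'] times the Wronskian. *)
have T'0 : T' = 0.
  have : det3 (x (T 0)) (T' *: s1 (T 0) + (V' *: x (T 0) + (V 0 * T') *: x1 (T 0))) (x2 (T 0)) = 0.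
    by rewrite E det3_0m.
  have -> : det3 (x (T 0)) (T' *: s1 (T 0) + (V' *: x (T 0) + (V 0 * T') *: x1 (T 0))) (x2 (T 0))
     = T' * det3 (x (T 0)) (s1 (T 0)) (x2 (T 0))
       + V 0 * T' * det3 (x (T 0)) (x1 (T 0)) (x2 (T 0)).
    by rewrite /det3 !mxE; ring.
  rewrite ruled mulr0 add0r VE => /eqP; rewrite !mulf_eq0 (negPf v0) (negPf (W0 _)) orbF.
  by move/eqP.
apply: (derive_coord_line nL) => i; have := chain _ _ i dn.
by rewrite T'0 mulr0 mxE.
Unshelve. all: by end_near. Qed.

(** One statement for both ends: a closed [Q] avoiding 0 leaves injectivity as the only question.
    Properness holds because the rulings have unit direction, so a point and its time determine [v]
    continuously and [v] is bounded over a compact set. *)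
Lemma cylinder_end_embedded (Q : set R) : closed Q -> ~ Q 0 ->
  proper_injective_immersion_on f (phi @` [set y | Q y.2]) <->
  (forall t1 t2 v1 v2, Q v1 -> Q v2 ->
    s t1 + v1 *: x t1 = s t2 + v2 *: x t2 -> eqmod (2 * pi) t1 t2).
Proof.
move=> clQ Q0; have [[cphi _] phiinj phisurj _] := cyl.
have per t v : phi (t + 2 * pi, v) = phi (t, v).
  by apply/phiinj; split=> //; exists 1; rewrite mulr1.
have vE t v : dot (v *: x t) (x t) = v.
  by rewrite -[RHS]mulr1 -(ux t) !dot3E !mxE; ring.
split=> [[_ inj _] t1 t2 v1 v2 Q1 Q2 E|inj].
  have /phiinj[] // : phi (t1, v1) = phi (t2, v2).
  apply: inj; [by rewrite inE; exists (t1, v1) | by rewrite inE; exists (t2, v2)|].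
  by rewrite !fE -!addrA E.
split.
- move=> K cK; have [->|K0] := eqVneq K set0.
    by rewrite preimage_set0 setI0; exact: compact0.
  have P0 : 0 < 2 * pi :> R by rewrite mulr_gt0// pi_gt0.
  have cs := curve_derive_continuous_mx ds; have cx := curve_derive_continuous_mx dx.
  (* Minus the absolute value of the ruling parameter recovered from a point and a time; its minimum
     over [K] and one period bounds [v] on the preimage of [K]. *)
  pose G (y : 'rV[R]_3 * R) := - `|dot (y.1 - b - s y.2) (x y.2)|.
  have cG : continuous G.
    move=> y; apply: cvgN; apply: cvg_norm.
    pose D (y : 'rV[R]_3 * R) := dot (y.1 - b - s y.2) (x y.2).
    suff : {for y, continuous D} by [].
    have -> : D = (fun y =>
      (y.1 0 0 - b 0 0 - s y.2 0 0) * x y.2 0 0 + (y.1 0 1 - b 0 1 - s y.2 0 1) * x y.2 0 1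
      + (y.1 0 2%:R - b 0 2%:R - s y.2 0 2%:R) * x y.2 0 2%:R).
      by apply/funext => z; rewrite /D dot3E !mxE.
    have cy i : {for y, continuous (fun y : 'rV[R]_3 * R => y.1 0 i)}.
      apply: (@continuous_comp _ _ _ fst (fun z : 'rV[R]_3 => z 0 i)).
        exact: cvg_fst.
      exact: coord_continuous.
    have on2 (c : R -> 'rV[R]_3) i : continuous c ->
        {for y, continuous (fun y : 'rV[R]_3 * R => c y.2 0 i)}.
      move=> cc; apply: (@continuous_comp _ _ _ (fun y : 'rV[R]_3 * R => c y.2)
        (fun z : 'rV[R]_3 => z 0 i)).
        by apply: (@continuous_comp _ _ _ snd c); [exact: cvg_snd | exact: cc].
      exact: coord_continuous.
    have term i : {for y, continuous (fun y : 'rV[R]_3 * R =>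
        (y.1 0 i - b 0 i - s y.2 0 i) * x y.2 0 i)}.
      apply: continuousM; last exact: on2.
      apply: continuousB; last exact: on2.
      by apply: continuousB; [exact: cy | exact: cvg_cst].
    exact: (continuousD (continuousD (term 0) (term 1)) (term 2%:R)).
  have KS0 : K `*` `[0, (2 * pi : R)]%classic !=set0.
    by have /set0P[y Ky] := K0; exists (y, 0 : R); split; rewrite //= in_itv/= lexx ltW.
  have [[y0 t0] _ Gmin] := compact_EVT_min KS0 (compact_setX cK (@segment_compact R 0 (2 * pi)))
    (continuous_subspaceT cG).
  pose m := `|G (y0, t0)|.
  pose A := (`[0, (2 * pi : R)]%classic `*` `[- m, m]%classic) `&`
    ([set y | Q y.2] `&` (f \o phi) @^-1` K).
  have -> : (phi @` [set y | Q y.2]) `&` f @^-1` K = phi @` A.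
    apply/seteqP; split=> [_ [[[t v] /= Qv <-] Kf]|_ [[t v] /= [_ [Qv Kf]] <-]].
      have [k k1] := eqmod_itv 0 t P0.
      have phik : phi (t + 2 * pi * k%:~R, v) = phi (t, v).
        exact: (periodicZ (per^~ v) t k).
      exists (t + 2 * pi * k%:~R, v) => //; split; last by split; rewrite //= phik.
      split; rewrite /= in_itv/=; first lra.
      rewrite -ler_norml /m.
      have := Gmin (f (phi (t, v)), t + 2 * pi * k%:~R).
      rewrite inE => /(_ _); rewrite {2}/G /=.
      have -> : f (phi (t, v)) - b - s (t + 2 * pi * k%:~R) = v *: x (t + 2 * pi * k%:~R).
        by apply/eqP; rewrite fE (periodicZ sP) (periodicZ xP) -addrA -opprD subr_eq addrC.
      rewrite vE.
      move=> H; have /H : (K `*` `[0, (2 * pi : R)]%classic) (f (phi (t, v)), t + 2 * pi * k%:~R).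
        by split; rewrite //= in_itv/=; lra.
      by rewrite /G normrN normr_id lerN2.
    by split=> //; exists (t, v).
  apply: continuous_compact; first exact: continuous_subspaceT.
  apply: compact_closedI.
    by apply: compact_setX; exact: segment_compact.
  apply: closedI.
    by apply: closed_comp => // y _; exact: cvg_snd.
  apply: closed_comp; last by apply: compact_closed => //; exact: norm_hausdorff.
  move=> y _; have -> : f \o phi = (fun y => b + s y.1 + y.2 *: x y.1).
    by apply/funext => -[t v] /=; rewrite fE.
  have on1 (c : R -> 'rV[R]_3) : continuous c -> {for y, continuous (fun y => c y.1)}.
    by move=> cc; apply: continuous_comp; [exact: cvg_fst | exact: cc].
  apply: cvgD; first by apply: cvgD; [exact: cvg_cst | exact: on1].
  by apply: cvgZ; [exact: cvg_snd | exact: on1].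
- move=> _ _ /set_mem[[t1 v1] /= Q1 <-] /set_mem[[t2 v2] /= Q2 <-].
  rewrite !fE -!addrA => /addrI E; have [k kE] := inj _ _ _ _ Q1 Q2 E.
  apply/phiinj; split => /=; first by exists k.
  rewrite kE (periodicZ sP) (periodicZ xP) in E; move/addrI: E => E.
  by rewrite -(vE t2 v1) E vE.
- move=> _ [[t v] /= Qv <-]; apply: cylinder_immersion.
  by apply/eqP => v0; apply: Q0; rewrite -v0.
Qed.

End CylinderFront.

(** * Both ends, the ruling directions and the dual curve combined *)

Lemma geodesic_curvature_neq0 (R : realType) (c : R -> 'rV[R]_3) t :
  geodesic_curvature c t != 0 ->
  det3 (c t) (derive1 c t) (derive1 (derive1 c) t) != 0.
Proof.
by rewrite /geodesic_curvature det_rows3 mulf_eq0 negb_or => /andP[].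
Qed.

Theorem theoremC (R : realType) (M : surface R) (f nu : M -> 'rV[R]_3)
    (phi : R * R -> M) (b : 'rV[R]_3) (a : R -> R) (xi nuh : R -> 'rV[R]_3)
    (M_connected : connected [set: M])
    (f_front : front f nu)
    (f_flat : flat nu)
    (f_complete : complete_front f)
    (f_singular : exists p, singular_point f p)
    (f_normal : normal_form f nu phi b a xi nuh) :
  (upper_end_properly_embedded f phi <-> lower_end_properly_embedded f phi) /\
  ((upper_end_properly_embedded f phi /\ lower_end_properly_embedded f phi) <->
   convex_curve nuh).
Proof.
have [cyl [sa aP] [[sx xP ux] _ kx] sigma0 [fE nuE [nuh_closed ortho]]] := f_normal.
have [sn nP un] := nuh_closed.
have P0 : 0 < 2 * pi :> R by rewrite mulr_gt0// pi_gt0.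
have cx := smooth_closed_C2_curve sx xP.
have cn := smooth_closed_C2_curve sn nP.
have cs := sigma_hat_closed_C2_curve sa aP sx xP sigma0.
have W0 t := geodesic_curvature_neq0 (kx t).
have nx t : dot (nuh t) (xi t) = 0 by case: (ortho t).
have nx1 t : dot (nuh t) (derive1 xi t) = 0 by case: (ortho t).
have ruled t : det3 (xi t) (derive1 xi t) (a t *: xi t) = 0.
  by rewrite /det3 !mxE; ring.
have ruled' t : det3 (xi t) (a t *: xi t) (derive1 (derive1 xi) t) = 0.
  by rewrite /det3 !mxE; ring.
have ends := cylinder_end_embedded f_front cyl (cc_derive cs) (cc_derive cx)
  (cc_derive cn) W0 ruled' ux (cc_period cs) xP fE nuE.
have inj := simple_ruled_injective P0 cs cx ruled W0 ux.
have emb := ruled_embedding_simple P0 cs cx W0 ux.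
have upper : upper_end_properly_embedded f phi <-> simple_closed (2 * pi) xi.
  have ends_u c (c0 : 0 < c) := ends [set v | c <= v] (@closed_ge R c)
    (elimN idP (negbT (lt_geF c0))).
  split=> [[c c0 /(ends_u c c0) emb_c]|sx']; first exact: (emb c).
  have [B B0 HB] := inj sx'; exists B => //; apply/(ends_u B B0) => t1 t2 v1 v2 _ v2B.
  by apply: HB; apply: le_trans v2B (ler_norm _).
have lower : lower_end_properly_embedded f phi <-> simple_closed (2 * pi) xi.
  (* The lower end is an upper end for the opposite ruling: [v *: xi t] equals
     [(- v) *: (- xi t)]. *)
  have cNx := closed_C2_curve_opp cx.
  have WN t : det3 (- xi t) (- derive1 xi t) (- derive1 (derive1 xi) t) != 0.
    by rewrite det3N oppr_eq0.
  have uNx t : dot (- xi t) (- xi t) = 1 by rewrite dotNN.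
  have Nc0 (c : R) : 0 < c -> ~~ (0 <= - c) by move=> c0; rewrite oppr_ge0 -ltNge.
  have ends_l c (c0 : 0 < c) := ends [set v | v <= - c] (@closed_le R (- c))
    (elimN idP (Nc0 c c0)).
  split=> [[c c0 /(ends_l c c0) emb_c]|sx'].
    move=> t1 t2 x12; apply: (ruled_embedding_simple P0 cs cNx WN uNx (v0 := c)).
      move=> u1 u2 v1 v2 cv1 cv2; rewrite !scalerN -!scaleNr => E.
      by apply: (emb_c u1 u2 (- v1) (- v2)) E; rewrite /= lerN2.
    by rewrite x12.
  have [B B0 HB] := inj sx'; exists B => //; apply/(ends_l B B0) => t1 t2 v1 v2 _ v2B.
  apply: HB; rewrite -normrN; apply: le_trans (ler_norm _).
  by rewrite lerNr.
have dual := dual_simpleP P0 cx cn W0 ux un nx nx1.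
(* Regularity and nonvanishing geodesic curvature of the dual are inherited from [xi], so convexity
   comes down to simplicity. *)
have convex : convex_curve nuh <-> simple_closed (2 * pi) nuh.
  split=> [[_ sn' _ _]|sn']; [exact: sn' | split; [exact: nuh_closed | exact: sn' | |]].
  - by move=> t; exact: (dual_regular cx cn W0 un nx nx1).
  - move=> t; rewrite /geodesic_curvature det_rows3 mulf_neq0//.
      exact: (dual_wronskian cx cn W0 ux un nx nx1).
    rewrite invr_eq0 expf_neq0// gt_eqF// sqrtr_gt0 lt0r dot3_ge0 andbT.
    apply: contra_neq (dual_regular cx cn W0 un nx nx1 t); exact: dot3_eq0.
split; first by rewrite upper lower.
rewrite convex -dual upper lower; tauto.
Qed.
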